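(* There is an absolute constant $C>0$ such that the following holds. Let $A\subseteq\mathbb{R}$ be a finite set with $|A|\ge2$, let $a\in\mathbb{R}$, and suppose that $|A(A+1)|=M|A|$ with $M\ge1$. Then $$\mathsf{E}^{\times}(A,A+a)\le C\,M^{\frac{14}{13}}|A|^{\frac{32}{13}}(\log|A|)^{\frac{71}{65}} .$$ In particular, $$\mathsf{E}^{\times}(A)\le C\,M^{\frac{14}{13}}|A|^{\frac{32}{13}}(\log|A|)^{\frac{71}{65}} .$$
   Context: $A+a=\{x+a: x\in A\}$ and $A(A+1)=\{x(y+1): x,y\in A\}$. For finite $A,B\subseteq\mathbb{R}$ the multiplicative energy is $\mathsf{E}^{\times}(A,B)=|\{(a_1,a_2,b_1,b_2)\in A^2\times B^2: a_1b_1=a_2b_2\}|$, and $\mathsf{E}^{\times}(A)=\mathsf{E}^{\times}(A,A)$. Logarithms are to base $2$. *)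

(* Defs.v *)
From mathcomp Require Import all_boot all_order all_algebra finmap.
From mathcomp Require Import all_classical all_reals all_analysis.

Set Implicit Arguments.
Unset Strict Implicit.
Unset Printing Implicit Defensive.

Import Order.TTheory GRing.Theory Num.Theory.
Local Open Scope fset_scope.
Local Open Scope ring_scope.

Definition translate (R : realType) (A : {fset R}) (a : R) : {fset R} :=
  [fset x + a | x in A].

Definition prodset (R : realType) (A B : {fset R}) : {fset R} :=
  [fset x * y | x in A, y in B].

(* A quadruple (a1, a2, b1, b2) is encoded as the pair of pairs
   ((a1, a2), (b1, b2)). *)
Definition mul_energy (R : realType) (A B : {fset R}) : nat :=
  #|` [fset q in (A `*` A) `*` (B `*` B) |
        q.1.1 * q.2.1 == q.1.2 * q.2.2] |.

Definition log2 (R : realType) (x : R) : R := ln x / ln 2.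

(* Main.v *)
(* Put D = (A + a) \ {0} and let rep D P x count the p in P with x p in D. If
   x p lies in D for t values of p, then for each shift k from a translate of A
   the line y = k (x X + c) contains t points of the grid P x A(A+1). A grid has
   few rich lines (elementary Szemeredi-Trotter for Cartesian products), hence
   the cubic bound sum_x rep D P x ^ 3 <= B |P|^2 for every finite P, with B of
   order M^2 |A| log |A|.
   Write r = rep D D and let g be the restriction of r to {r <= T}. The matrix
   r(y / z) on D is positive semidefinite and dominates g(y / z), so a three-walk
   inequality bounds (sum r g)^3 by |D|^3 times the sum of
   g(y / x) g(z / x) r(y / z) over triples in D. By Cauchy-Schwarz that sum is
   controlled by sum r^3 and by the sum of g(u)^2 g(v)^2 r(u / v)^2 over ratios
   u, v; the latter is estimated by trading the smallest of the three factors
   for T^(1/2) and fourth roots of the other two, and then by the cubic bound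
   applied to the level sets of r. The part r > T contributes at most
   sum r^3 / T. Taking T = M^(12/13) |A|^(7/13) gives the exponents 14/13 and
   32/13, with a single logarithm. The mixed energy of A and A + a is at most the
   mean of the energies of the two sets, up to quadruples involving 0. *)
Require Import Defs.
From mathcomp Require Import all_boot all_order all_algebra finmap.
From mathcomp Require Import all_classical all_reals all_analysis.
From mathcomp Require Import zify ring lra.

Set Implicit Arguments.
Unset Strict Implicit.
Unset Printing Implicit Defensive.

Import Order.TTheory GRing.Theory Num.Theory.
Local Open Scope fset_scope.
Local Open Scope ring_scope.

(** * Ranks, collisions and rich lines in a grid *)

Lemma leq_sum_in (T : eqType) (s : seq T) (F G : T -> nat) :
  (forall x, x \in s -> F x <= G x)%N ->
  (\sum_(x <- s) F x <= \sum_(x <- s) G x)%N.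
Proof. by move=> FG; rewrite !big_seq; apply: leq_sum. Qed.

Lemma sum_nat_bool (T : Type) (a : pred T) (s : seq T) :
  (\sum_(x <- s) a x = count a s)%N.
Proof. by elim: s => [|x s IH]; rewrite ?big_nil // big_cons IH. Qed.

Definition rank (R : realFieldType) (X : {fset R}) (p : R) : nat :=
  count (fun q => q < p) X.

Lemma rank_le (R : realFieldType) (X : {fset R}) (p q : R) :
  p <= q -> (rank X p <= rank X q)%N.
Proof. by move=> pq; apply: sub_count => x /= /lt_le_trans; apply. Qed.

Lemma rank_lt (R : realFieldType) (X : {fset R}) (p q : R) :
  p \in X -> p < q -> (rank X p < rank X q)%N.
Proof.
move=> pX pq.
have := count_predUI (fun x => x < p) (pred1 p) X.
have -> : count (predI (fun x => x < p) (pred1 p)) X = 0%N.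
  rewrite -(@eq_count _ pred0) ?count_pred0 // => x /=.
  by apply/esym/negbTE/negP => /andP[xp /eqP e]; rewrite e ltxx in xp.
rewrite count_uniq_mem ?fset_uniq // pX addn0 addn1 => <-.
apply: sub_count => x /= /orP[/lt_trans|/eqP ->//]; exact.
Qed.

Lemma rank_inj (R : realFieldType) (X : {fset R}) :
  {in X &, injective (rank X)}.
Proof.
move=> p q pX qX e; case: (ltgtP p q) => // /rank_lt.
- by move=> /(_ X pX); rewrite e ltnn.
- by move=> /(_ X qX); rewrite e ltnn.
Qed.

Lemma rank_bound (R : realFieldType) (X : {fset R}) (p : R) :
  p \in X -> (rank X p < #|` X|)%N.
Proof.
move=> pX; rewrite -[X in (_ < X)%N](count_predT X).
have := count_predC (fun x => x < p) X.
rewrite -(count_predT X) => <-; rewrite -addn1 leq_add2l -has_count.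
by apply/hasP; exists p => //=; rewrite ltxx.
Qed.

(** [rank X] is injective on [X], so a fibre embeds into the [g] integers from [v * g] on. Quotients
    of ranks thus cut [X] into consecutive blocks of at most [g] points. *)
Lemma rank_fiber (R : realFieldType) (X : {fset R}) (g v : nat) :
  (0 < g)%N -> (\sum_(q <- X) (rank X q %/ g == v) <= g)%N.
Proof.
move=> g0; rewrite sum_nat_bool -size_filter.
rewrite -[leqRHS](size_iota (v * g)).
rewrite -(size_map (rank X)); apply: uniq_leq_size.
  rewrite map_inj_in_uniq ?filter_uniq ?fset_uniq // => p q.
  by rewrite !mem_filter => /andP[_ ?] /andP[_ ?]; apply: rank_inj.
move=> _ /mapP[q + ->]; rewrite mem_filter => /andP[/eqP <- _].
by rewrite mem_iota leq_divM addnC -mulSn ltn_ceil.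
Qed.

(** Induction on [I]: a further point either takes a new value of [phi] or collides with a point
    already present, which adds at least two ordered pairs. *)
Lemma pair_pigeonhole (T : eqType) (phi : T -> nat) (I : seq T) : uniq I ->
  (2 * size I <= 2 * size (undup (map phi I))
     + \sum_(p <- I) \sum_(q <- I) ((p != q) && (phi p == phi q)))%N.
Proof.
elim: I => [|p0 I IH] //= /andP[p0I uI]; have {}IH := IH uI.
rewrite !big_cons eqxx /= add0n.
under [X in (_ <= _ + (_ + X))%N]eq_bigr do rewrite big_cons.
rewrite big_split /=.
have e : (\sum_(i <- I) ((i != p0) && (phi i == phi p0)) =
          \sum_(j <- I) ((p0 != j) && (phi p0 == phi j)))%N.
  by apply: eq_bigr => i _; rewrite eq_sym [phi i == _]eq_sym.
rewrite e; move: (\sum_(i <- I) \sum_(q <- I) _)%N IH => W.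
case: ifPn => [/mapP[q qI pq]|_] /=; set u := size (undup _); last first.
  by move: u (\sum_(j <- I) _)%N => u S; lia.
have : (1 <= \sum_(j <- I) ((p0 != j) && (phi p0 == phi j)))%N.
  rewrite (big_rem q) //= pq eqxx andbT.
  by rewrite (_ : p0 != q) //; apply/negP => /eqP h; rewrite h qI in p0I.
by move: u (\sum_(j <- I) _)%N => u S; lia.
Qed.

(* Cutting [X] and [Y] into about [t / 8] blocks each, a line of nonzero slope
   meets at most [t / 2] cells, hence has at least [t] ordered pairs of distinct
   points lying in a common cell; each such pair belongs to a single line. *)
Lemma rich_lines (R : realFieldType) (Lam : {fset R * R}) (X Y : {fset R})
    (t : nat) :
  (4 <= t)%N ->
  (forall l, l \in Lam -> l.1 != 0 /\
     (t <= count (fun p => (l.1 * p + l.2)%R \in Y) X)%N) ->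
  (t ^ 3 * #|` Lam| <= 81 * (#|` X| ^ 2 * #|` Y| ^ 2))%N.
Proof.
move=> t4 rich.
have [->|/fset0Pn[l0 l0L]] := eqVneq Lam fset0; first by rewrite cardfs0 muln0.
have [tX tY] : (t <= #|` X|)%N /\ (t <= #|` Y|)%N.
  have [s0 h] := rich _ l0L; split; apply: leq_trans h _.
    exact: count_size.
  rewrite -size_filter -(size_map (fun p => l0.1 * p + l0.2)).
  apply: uniq_leq_size.
    rewrite map_inj_uniq ?filter_uniq ?fset_uniq // => p q.
    by move/addIr/(mulfI s0).
  by move=> _ /mapP[q + ->]; rewrite mem_filter => /andP[].
(* The successor gives [8 |Z| < block Z * t], so cell indices stay at most [t %/ 8]; since
   [t <= |Z|], still [block Z * t <= 9 |Z|], and [81 = 9 ^ 2]. *)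
pose block (Z : {fset R}) := ((8 * #|` Z|) %/ t).+1.
pose cell (Z : {fset R}) p := (rank Z p %/ block Z)%N.
have cell_bound Z p : (t <= #|` Z|)%N -> p \in Z -> (cell Z p <= t %/ 8)%N.
  move=> tZ /rank_bound pZ; rewrite leq_divRL //.
  have h1 : (cell Z p * block Z <= rank Z p)%N by apply: leq_divM.
  have h2 : (8 * #|` Z| < block Z * t)%N by rewrite ltn_ceil //; lia.
  rewrite leqNgt; apply/negP => /leq_mul/(_ (leqnn (block Z))) h3.
  have {}h3 : (block Z * t <= 8 * (cell Z p * block Z))%N.
    rewrite mulnA [(8 * _)%N]mulnC [(block Z * t)%N]mulnC.
    by apply: leq_trans h3; rewrite leq_mul2r leqnSn orbT.
  by move: h1 h2 h3 pZ; move: (cell Z p * block Z)%N (block Z * t)%N; lia.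
have block_bound Z : (t <= #|` Z|)%N -> (block Z * t <= 9 * #|` Z|)%N.
  move=> tZ; rewrite /block mulSn.
  by have := leq_divM (8 * #|` Z|) t; lia.
have cell_le Z p q : p <= q -> (cell Z p <= cell Z q)%N.
  by move=> pq; apply: leq_div2r; apply: rank_le.
pose good (l : R * R) p q := [&& p != q, cell X p == cell X q,
  l.1 * p + l.2 \in Y, l.1 * q + l.2 \in Y
  & cell Y (l.1 * p + l.2) == cell Y (l.1 * q + l.2)].
have lower l : l \in Lam ->
    (t <= \sum_(p <- X) \sum_(q <- X) good l p q)%N.
  move=> lL; have [s0 tl] := rich _ lL.
  pose y p := l.1 * p + l.2.
  pose I := [seq p <- X | y p \in Y].
  (* Column index plus row index, the latter reversed for negative slope. Both summands are
     nondecreasing along the line, so equal values of [phi] force equal cells, while [phi] takes at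
     most [t %/ 4 + 1] values. *)
  pose phi p := (cell X p +
    (if (0 < l.1)%R then cell Y (y p) else t %/ 8 - cell Y (y p)))%N.
  have mI p : p \in I -> (p \in X) /\ (y p \in Y).
    by rewrite mem_filter => /andP[].
  have : (2 * size I <= 2 * size (undup (map phi I)) +
      \sum_(p <- I) \sum_(q <- I) ((p != q) && (phi p == phi q)))%N.
    exact/pair_pigeonhole/filter_uniq/fset_uniq.
  have sI : (t <= size I)%N by rewrite size_filter.
  have : (size (undup (map phi I)) <= (t %/ 4).+1)%N.
    rewrite -[X in (_ <= X)%N](size_iota 0); apply: uniq_leq_size.
      exact: undup_uniq.
    move=> v; rewrite mem_undup => /mapP[p /mI[pX pY] ->].
    rewrite mem_iota /= add0n /phi.
    have := cell_bound _ _ tX pX; have := cell_bound _ _ tY pY.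
    by case: ifP => _; clear; lia.
  have : (\sum_(p <- I) \sum_(q <- I) ((p != q) && (phi p == phi q)) <=
          \sum_(p <- X) \sum_(q <- X) good l p q)%N.
    rewrite big_filter big_mkcond /=; apply: leq_sum_in => p pX.
    case: ifP => // ypY; rewrite big_filter big_mkcond /=.
    apply: leq_sum_in => q qX; case: ifP => // yqY.
    case: (eqVneq p q) => //= pq; case: eqP => //= ephi.
    suff : cell X p = cell X q /\ cell Y (y p) = cell Y (y q).
      by rewrite /good pq ypY yqY /= => -[-> ->]; rewrite !eqxx.
    wlog: p q pX ypY qX yqY pq ephi / p <= q.
      move=> W; case/orP: (le_total p q) => h; first exact: W.
      rewrite eq_sym in pq.
      by have [-> ->] := W q p qX yqY pX ypY pq (esym ephi) h.
    move=> le_pq; have hX := cell_le X _ _ le_pq; rewrite /phi in ephi.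
    have hp := cell_bound _ _ tY ypY; have hq := cell_bound _ _ tY yqY.
    case: ifPn ephi => s1 ephi.
      have : y p <= y q by rewrite lerD2r ler_pM2l.
      by move/(cell_le Y); move: hX ephi hp hq; clear; lia.
    have : y q <= y p.
      by rewrite lerD2r ler_nM2l // lt_neqAle s0 leNgt.
    by move/(cell_le Y); move: hX ephi hp hq; clear; lia.
  (* At least [2 * t - 2 * (t %/ 4 + 1)] collisions occur, and this is at least [t] because
     [t >= 4]. *)
  set u := size (undup _); move: u (\sum_(p <- I) _)%N => u v.
  move: (\sum_(p <- X) _)%N => w. clear -sI t4; lia.
have upper : (\sum_(l <- Lam) \sum_(p <- X) \sum_(q <- X) good l p q <=
    (#|` X| * block X) * (#|` Y| * block Y))%N.
  have same (Z : {fset R}) : (\sum_(p <- Z) \sum_(q <- Z) (cell Z p == cell Z q) <=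
      #|` Z| * block Z)%N.
    rewrite -sum1_size big_distrl /=; apply: leq_sum => p _; rewrite mul1n.
    under eq_bigr do rewrite eq_sym.
    exact: rank_fiber.
  rewrite exchange_big /=; under eq_bigr do rewrite exchange_big /=.
  apply: leq_trans (leq_mul (same X) (leqnn _)).
  rewrite big_distrl /=; apply: leq_sum => p _.
  rewrite big_distrl /=; apply: leq_sum => q _.
  case: (eqVneq p q) => [<-|pq].
    by rewrite big1 // => l _; rewrite /good eqxx.
  case: (eqVneq (cell X p) (cell X q)) => [e|ne]; last first.
    by rewrite big1 // => l _; rewrite /good (negbTE ne) andbF.
  rewrite mul1n; apply: leq_trans (same Y).
  rewrite sum_nat_bool -size_filter.
  (* A line is determined by its values at the distinct points [p] and [q], so the lines counted for
     this pair inject into the pairs of [Y] lying in a common cell. *)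
  pose F (l : R * R) := (l.1 * p + l.2, l.1 * q + l.2).
  pose E := [seq (y, z) | y <- Y, z <- [seq z <- Y | cell Y y == cell Y z]].
  have -> : (\sum_(y <- Y) \sum_(z <- Y) (cell Y y == cell Y z) = size E)%N.
    rewrite size_allpairs_dep sumnE big_map; apply: eq_bigr => y _.
    by rewrite sum_nat_bool size_filter.
  rewrite -(size_map F); apply: uniq_leq_size.
    rewrite map_inj_uniq ?filter_uniq ?fset_uniq // => -[s c] [s' c'] [].
    move=> /= e1 e2.
    have : (s - s') * (p - q) = 0.
      rewrite mulrBl !mulrBr; apply/eqP; rewrite subr_eq0; apply/eqP.
      have -> : s * p - s * q = (s * p + c) - (s * q + c) by ring.
      by rewrite e1 e2; ring.
    move=> /eqP; rewrite mulf_eq0 !subr_eq0 (negbTE pq) orbF => /eqP es.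
    by move: e1; rewrite es => /addrI ->.
  move=> _ /mapP[l + ->]; rewrite mem_filter => /andP[/and5P[_ _ h1 h2 h3] _].
  by apply/allpairsPdep; exists (l.1 * p + l.2), (l.1 * q + l.2);
    rewrite mem_filter h1 h2 h3.
have : (\sum_(l <- Lam) t <= (#|` X| * block X) * (#|` Y| * block Y))%N.
  by apply: leq_trans upper; apply: leq_sum_in => l lL; apply: lower.
rewrite big_const_seq count_predT iter_addn_0 => h.
have bX := block_bound _ tX; have bY := block_bound _ tY.
have -> : (t ^ 3 * #|` Lam| = t * t * (t * #|` Lam|))%N by ring.
apply: leq_trans (leq_mul (leqnn _) h) _.
have -> : (t * t * (#|` X| * block X * (#|` Y| * block Y)) =
  #|` X| * #|` Y| * ((block X * t) * (block Y * t)))%N by ring.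
apply: leq_trans (leq_mul (leqnn _) (leq_mul bX bY)) _.
by apply: eq_leq; ring.
Qed.

(** * Level sets and the third moment of representation counts *)

Lemma perm_fsetM (T U : choiceType) (A : {fset T}) (B : {fset U}) :
  perm_eq (A `*` B) [seq (x, y) | x <- A, y <- B].
Proof.
apply: uniq_perm; rewrite ?fset_uniq //.
  by apply: allpairs_uniq; rewrite ?fset_uniq // => -[? ?] [? ?] _ _ [-> ->].
move=> [x y]; rewrite in_fsetM /=.
by apply/andP/allpairsP => [[xA yB]|[[x' y'] /= [? ? [-> ->]]]] //; exists (x, y).
Qed.

Lemma cardfsM (T U : choiceType) (A : {fset T}) (B : {fset U}) :
  #|` A `*` B| = (#|` A| * #|` B|)%N.
Proof. by rewrite (perm_size (perm_fsetM A B)) size_allpairs. Qed.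

Lemma perm_fset_filter (T : choiceType) (a : pred T) (X : {fset T}) :
  perm_eq [fset x in X | a x] [seq x <- X | a x].
Proof.
apply: uniq_perm; rewrite ?fset_uniq //; first exact/filter_uniq/fset_uniq.
by move=> x; rewrite !inE mem_filter andbC.
Qed.

Lemma card_fset_filter (T : choiceType) (a : pred T) (X : {fset T}) :
  #|` [fset x in X | a x]| = count a X.
Proof. by rewrite (perm_size (perm_fset_filter a X)) size_filter. Qed.

Lemma sum_count_layers (R : comPzRingType) (T : eqType) (s : seq T)
    (r : T -> nat) (n : nat) (f : nat -> R) :
  {in s, forall x, (r x <= n)%N} ->
  \sum_(x <- s) \sum_(1 <= t < (r x).+1) f t =
  \sum_(1 <= t < n.+1) f t * (count (fun x => (t <= r x)%N) s)%:R.
Proof.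
move=> rn; under [RHS]eq_bigr => t _ do
  rewrite -sum_nat_bool natr_sum mulr_sumr.
rewrite exchange_big /=; apply: eq_big_seq => x /rn rxn.
rewrite (@big_cat_nat _ _ _ (r x).+1 1 n.+1) //=.
rewrite [X in _ = _ + X]big_nat [X in _ = _ + X]big1 ?addr0; last first.
  by move=> t /andP[rt _]; rewrite leqNgt rt mulr0.
by apply: eq_big_nat => t /andP[_]; rewrite ltnS => ->; rewrite mulr1.
Qed.

(** Induction, since [(r + 1) ^ 3 - r ^ 3 <= 3 (r + 1) ^ 2]. *)
Lemma cube_le_sum_squares (r : nat) :
  (r ^ 3 <= 3 * \sum_(1 <= t < r.+1) t ^ 2)%N.
Proof.
elim: r => [|r IH]; first by rewrite big_geq.
by rewrite big_nat_recr //=; move: (\sum_(_ <= _ < _) _)%N IH => S; nia.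
Qed.

(** For [P = D] with [0] outside [D], this is the number of ways to write [x] as a ratio of two
    elements of [D]. *)
Definition rep (R : fieldType) (D P : {fset R}) (x : R) : nat :=
  (\sum_(p <- P) ((x * p)%R \in D))%N.

Definition harmonic_sum (R : realFieldType) (n : nat) : R :=
  \sum_(1 <= t < n.+1) t%:R^-1.

Lemma count_mulr_le (R : fieldType) (D : {fset R}) (x : R) (P : seq R) :
  0 \notin D -> uniq P -> (count (fun p => (x * p)%R \in D) P <= #|` D|)%N.
Proof.
move=> D0 uP; have [->|x0] := eqVneq x 0.
  by rewrite (@eq_count _ _ pred0) ?count_pred0 // => p; rewrite mul0r (negbTE D0).
rewrite -size_filter -(size_map (fun p => x * p)); apply: uniq_leq_size.
  by rewrite map_inj_uniq ?filter_uniq //; apply: mulfI.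
by move=> _ /mapP[p + ->]; rewrite mem_filter => /andP[].
Qed.

Lemma rep_le_card (R : fieldType) (D P : {fset R}) (x : R) :
  0 \notin D -> (rep D P x <= #|` D|)%N.
Proof. by move=> D0; rewrite /rep sum_nat_bool count_mulr_le ?fset_uniq. Qed.

Lemma sum_rep_le (R : fieldType) (D P X : {fset R}) :
  0 \notin D -> (\sum_(x <- X) rep D P x <= #|` D| * #|` P|)%N.
Proof.
move=> D0; rewrite exchange_big mulnC -sum1_size big_distrl /=.
apply: leq_sum => p _; rewrite mul1n sum_nat_bool.
by under eq_count do rewrite mulrC; apply: count_mulr_le (fset_uniq _).
Qed.

(** A pair [(x, k)] yields the line of slope [k x] and intercept [k c]. Whenever [x p] lies in [D],
    its height at [p] is [k (x p + c)], an element of [C]; so the line is rich in the grid of [P]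
    and [C]. As [k] and [c] are nonzero, distinct pairs give distinct lines. *)
Lemma rep_level (R : realFieldType) (D K C P X : {fset R}) (c : R) (t : nat) :
  0 \notin D -> 0 \notin K -> c != 0 ->
  {in K & D, forall k d, k * (d + c) \in C} -> (4 <= t)%N ->
  (t ^ 3 * (count (fun x => t <= rep D P x) X * #|` K|)
     <= 81 * (#|` P| ^ 2 * #|` C| ^ 2))%N.
Proof.
move=> D0 K0 c0 KD t4; rewrite -card_fset_filter.
set S := [fset x in X | _]; rewrite -cardfsM.
pose F (z : R * R) := (z.2 * z.1, z.2 * c).
have <- : #|` [fset F z | z in S `*` K]| = #|` S `*` K|.
  apply: card_in_imfset => -[x k] [x' k'] /=; rewrite !in_fsetM /=.
  move=> /andP[_ kK] _ [ekx /(mulIf c0) ek]; move: ekx; rewrite -ek.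
  have k0 : k != 0 by apply: contraNneq K0 => <-.
  by move/(mulfI k0) ->.
apply: rich_lines => // _ /imfsetP[[x k] + ->] /=.
rewrite in_fsetM /= !inE => /andP[/andP[_ tx] kK].
have k0 : k != 0 by apply: contraNneq K0 => <-.
split.
  rewrite mulf_neq0 //; apply/negP => /eqP x0; move: tx; rewrite x0 /rep.
  rewrite big1 ?leqn0 => [/eqP t0|p _]; first by rewrite t0 in t4.
  by rewrite mul0r (negbTE D0).
apply: leq_trans tx _; rewrite /rep sum_nat_bool; apply: sub_count => p /= xpD.
by rewrite -mulrA -mulrDr KD.
Qed.

(** Summation over levels: [t ^ 2] times the size of a level set is of order [1 / t], whence the
    harmonic sum. In [486 = 3 * 162], the [3] comes from cutting the cube into layers and
    [162 = 2 * 81] from [n <= 2 |K|]. *)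
Lemma sum_rep_cube (R : realFieldType) (D K C P X : {fset R}) (c V : R)
    (n : nat) :
  0 \notin D -> 0 \notin K -> c != 0 ->
  {in K & D, forall k d, k * (d + c) \in C} ->
  (#|` D| <= n)%N -> (n <= 2 * #|` K|)%N -> 1 <= V ->
  #|` C|%:R ^+ 2 <= V * n%:R ^+ 2 ->
  \sum_(x <- X) (rep D P x)%:R ^+ 3 <=
  486 * V * n%:R * harmonic_sum R n * #|` P|%:R ^+ 2.
Proof.
move=> D0 K0 c0 KD Dn nK V1 CV.
have [n0|n0] := posnP n.
  rewrite big1 ?n0 ?(mulr0, mul0r) // => x _.
  have := rep_le_card P x D0.
  by move=> /leq_trans/(_ Dn); rewrite n0 leqn0 => /eqP ->; rewrite expr0n.
have level t : (1 <= t)%N ->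
    t%:R ^+ 3 * (count (fun x => t <= rep D P x)%N X)%:R <=
    162 * V * n%:R * #|` P|%:R ^+ 2.
  move=> t1; set s := count _ _.
  have nR : 0 < n%:R :> R by rewrite ltr0n.
  have [t4|t4] := leqP 4 t.
    have h : t%:R ^+ 3 * s%:R * #|` K|%:R <=
        81 * (#|` P|%:R ^+ 2 * #|` C|%:R ^+ 2) :> R.
      by rewrite -!natrX -!natrM ler_nat -mulnA; apply: rep_level c0 KD t4.
    rewrite -(ler_pM2r nR).
    have nK' : n%:R <= 2 * #|` K|%:R :> R by rewrite -natrM ler_nat.
    have a0 : 0 <= t%:R ^+ 3 * s%:R :> R by rewrite mulr_ge0 ?exprn_ge0.
    have b0 : 0 <= #|` P|%:R ^+ 2 :> R by rewrite exprn_ge0.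
    have h1 := ler_wpM2l a0 nK'; have h2 := ler_wpM2l b0 CV.
    lra.
  (* For [t < 4] the bound on rich lines does not apply; [t ^ 3 <= 27] and the trivial count of
     pairs suffice. *)
  have st : (t ^ 3 * s <= 27 * (#|` D| * #|` P|))%N.
    apply: leq_mul; first by rewrite -[27%N]/(3 ^ 3)%N leq_exp2r.
    apply: leq_trans (sum_rep_le P X D0); rewrite /s -sum_nat_bool.
    by apply: leq_sum => x _; case: (leqP t) => // h; apply: leq_trans h.
  have st' : t%:R ^+ 3 * s%:R <= 27 * (n%:R * #|` P|%:R ^+ 2) :> R.
    rewrite -!natrX -!natrM ler_nat; apply: leq_trans st _.
    rewrite leq_mul2l /=; apply: leq_mul => //.
    by case: #|` P| => // m; rewrite -mulnn leq_pmulr.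
  have b0 : 0 <= n%:R * #|` P|%:R ^+ 2 :> R by rewrite mulr_ge0 ?exprn_ge0.
  have := ler_wpM2l b0 V1; lra.
have h x : (rep D P x)%:R ^+ 3 <=
    \sum_(1 <= t < (rep D P x).+1) 3 * t%:R ^+ 2 :> R.
  rewrite -natrX; apply: le_trans
    (_ : (3 * \sum_(1 <= t < (rep D P x).+1) t ^ 2)%N%:R <= _).
    by rewrite ler_nat cube_le_sum_squares.
  by rewrite natrM natr_sum mulr_sumr; apply: ler_sum => t _; rewrite natrX.
apply: le_trans (ler_sum _ (fun x _ => h x)) _.
rewrite (@sum_count_layers _ _ _ _ n); last first.
  by move=> x _; apply: leq_trans Dn; apply: rep_le_card.
rewrite /harmonic_sum mulrAC mulr_sumr; apply: ler_sum_nat => t /andP[t1 _].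
have tR : 0 < t%:R :> R by rewrite ltr0n.
rewrite ler_pdivlMr //; have := level t t1; lra.
Qed.

(** * Cauchy-Schwarz, Gram matrices and three-step walks *)

Lemma Cauchy_Schwarz_sum (R : realFieldType) (I : Type) (s : seq I)
    (a b : I -> R) :
  (\sum_(i <- s) a i * b i) ^+ 2 <=
  (\sum_(i <- s) a i ^+ 2) * (\sum_(i <- s) b i ^+ 2).
Proof.
have h u v : 0 <= u ^+ 2 * (\sum_(i <- s) a i ^+ 2)
    - 2 * u * v * (\sum_(i <- s) a i * b i) + v ^+ 2 * (\sum_(i <- s) b i ^+ 2).
  have -> : u ^+ 2 * (\sum_(i <- s) a i ^+ 2)
      - 2 * u * v * (\sum_(i <- s) a i * b i) + v ^+ 2 * (\sum_(i <- s) b i ^+ 2)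
      = \sum_(i <- s) (u * a i - v * b i) ^+ 2.
    elim: s => [|i s IH]; first by rewrite !big_nil; ring.
    by rewrite !big_cons -IH; ring.
  by apply: sumr_ge0 => i _; apply: sqr_ge0.
have A0 : 0 <= \sum_(i <- s) a i ^+ 2 by apply: sumr_ge0 => i _; apply: sqr_ge0.
have B0 : 0 <= \sum_(i <- s) b i ^+ 2 by apply: sumr_ge0 => i _; apply: sqr_ge0.
move: A0 B0 h; set A := \sum_(i <- s) a i ^+ 2; set B := \sum_(i <- s) b i ^+ 2.
set S := \sum_(i <- s) a i * b i => A0 B0 h.
(* If [B = 0], the form at [(S, A + 1)] equals [- (A + 2) S ^ 2], hence [S = 0]; otherwise the form
   at [(B, S)] is [B (A B - S ^ 2)]. *)
have [Bz|Bnz] := eqVneq B 0.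
  have := h S (A + 1); rewrite Bz; have := sqr_ge0 S; nra.
have Bp : 0 < B by rewrite lt_neqAle eq_sym Bnz.
rewrite -subr_ge0 -(pmulr_rge0 _ Bp).
have := h B S; rewrite (_ : _ + _ = B * (A * B - S ^+ 2)) //; ring.
Qed.

Lemma Cauchy_Schwarz_sum2 (R : realFieldType) (I J : Type) (s : seq I)
    (t : seq J) (a b : I -> J -> R) :
  (\sum_(i <- s) \sum_(j <- t) a i j * b i j) ^+ 2 <=
  (\sum_(i <- s) \sum_(j <- t) a i j ^+ 2) *
  (\sum_(i <- s) \sum_(j <- t) b i j ^+ 2).
Proof.
have e (c : I -> J -> R) : \sum_(i <- s) \sum_(j <- t) c i j =
    \sum_(k <- [seq (i, j) | i <- s, j <- t]) c k.1 k.2.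
  by rewrite big_allpairs.
by rewrite !e Cauchy_Schwarz_sum.
Qed.

Lemma sum_gram (R : comPzRingType) (I J : Type) (s : seq I) (t : seq J)
    (a : I -> R) (chi : J -> I -> R) :
  \sum_(i <- s) \sum_(k <- s) a i * a k * \sum_(j <- t) chi j i * chi j k =
  \sum_(j <- t) (\sum_(i <- s) a i * chi j i) ^+ 2.
Proof.
under eq_bigr => i _ do under eq_bigr => k _ do rewrite mulr_sumr.
under eq_bigr => i _ do rewrite exchange_big.
rewrite exchange_big /=; apply: eq_bigr => j _.
rewrite expr2 big_distrl /=; apply: eq_bigr => i _.
by rewrite big_distrr /=; apply: eq_bigr => k _; ring.
Qed.

(** Both sides expand to the same fourfold sum: the two Gram matrices of [chi], of its rows and of
    its columns, have equal Frobenius norm. *)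
Lemma sum_gram_sqr (R : comPzRingType) (I J : Type) (s : seq I) (t : seq J)
    (chi : J -> I -> R) :
  \sum_(i <- s) \sum_(k <- s) (\sum_(j <- t) chi j i * chi j k) ^+ 2 =
  \sum_(j <- t) \sum_(l <- t) (\sum_(i <- s) chi j i * chi l i) ^+ 2.
Proof.
have e1 i k : (\sum_(j <- t) chi j i * chi j k) ^+ 2 =
    \sum_(j <- t) \sum_(l <- t) (chi j i * chi l i) * (chi j k * chi l k).
  rewrite expr2 big_distrl /=; apply: eq_bigr => j _.
  by rewrite big_distrr /=; apply: eq_bigr => l _; ring.
have e2 j l : (\sum_(i <- s) chi j i * chi l i) ^+ 2 =
    \sum_(i <- s) \sum_(k <- s) (chi j i * chi l i) * (chi j k * chi l k).
  rewrite expr2 big_distrl /=; apply: eq_bigr => i _.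
  by rewrite big_distrr.
under eq_bigr => i _ do under eq_bigr => k _ do rewrite e1.
under [RHS]eq_bigr => j _ do under eq_bigr => l _ do rewrite e2.
under eq_bigr => i _ do rewrite exchange_big /=.
rewrite exchange_big /=; apply: eq_bigr => j _.
under eq_bigr => i _ do rewrite exchange_big /=.
by rewrite exchange_big.
Qed.

(** The arithmetic-geometric mean inequality for [a * b], [l ^ 3 / a] and [l ^ 3 / b], whose product
    is [l ^ 6]. *)
Lemma AMGM3_inv (R : rcfType) (a b l : R) : 0 < a -> 0 < b -> 0 < l ->
  l ^+ 2 * (3 - l / a - l / b) <= a * b.
Proof.
move=> a0 b0 l0; have ab0 := mulr_gt0 a0 b0.
rewrite -(ler_pM2r ab0).
have -> : l ^+ 2 * (3 - l / a - l / b) * (a * b) =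
    3 * l ^+ 2 * (a * b) - l ^+ 3 * (a + b).
  by field; rewrite !gt_eqF.
rewrite -subr_ge0 -(sqr_sqrtr (ltW a0)) -(sqr_sqrtr (ltW b0)).
move: (Num.sqrt a) (Num.sqrt b) (sqrtr_ge0 a) (sqrtr_ge0 b) => u v u0 v0.
have -> : u ^+ 2 * v ^+ 2 * (u ^+ 2 * v ^+ 2) -
    (3 * l ^+ 2 * (u ^+ 2 * v ^+ 2) - l ^+ 3 * (u ^+ 2 + v ^+ 2)) =
    u * v * (u * v - l) ^+ 2 * (u * v + 2 * l) + l ^+ 3 * (u - v) ^+ 2 by ring.
have l0' := ltW l0.
by apply: addr_ge0; rewrite ?(sqr_ge0, exprn_ge0, mulr_ge0, addr_ge0).
Qed.

(** Read [G] as a weighted graph with degrees [d]. [AMGM3_inv] is applied to the two degrees at each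
    edge, with [l] the mean degree, and summed with weights [G x y]; the terms in [l / d x] and
    [l / d y] amount to at most [m] each, leaving [l ^ 2 * m]. *)
Lemma three_walks (R : rcfType) (I : eqType) (s : seq I) (G : I -> I -> R) :
  (forall x y, 0 <= G x y) -> (forall x y, G x y = G y x) ->
  (\sum_(x <- s) \sum_(y <- s) G x y) ^+ 3 <=
  (size s)%:R ^+ 2 * \sum_(x <- s) \sum_(y <- s)
    (\sum_(z <- s) G x z) * (\sum_(z <- s) G y z) * G x y.
Proof.
move=> G0 GC; pose d x := \sum_(z <- s) G x z.
have d0 x : 0 <= d x by apply: sumr_ge0.
set m := \sum_(x <- s) _; set W := \sum_(x <- s) _.
have m0 : 0 <= m by apply: sumr_ge0 => x _; apply: d0.
have W0 : 0 <= W.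
  by apply: sumr_ge0 => x _; apply: sumr_ge0 => y _; rewrite !mulr_ge0 // d0.
have [mz|mnz] := eqVneq m 0; first by rewrite mz expr0n mulr_ge0 ?exprn_ge0.
have [s0|s0] := posnP (size s).
  by move: mnz; rewrite /m (size0nil s0) big_nil eqxx.
have n0 : 0 < (size s)%:R :> R by rewrite ltr0n.
have mp : 0 < m by rewrite lt_neqAle eq_sym mnz.
pose l := m / (size s)%:R; have l0 : 0 < l by rewrite divr_gt0.
have dpos x y : x \in s -> y \in s -> G x y != 0 -> 0 < d x.
  move=> xs ys Gxy; apply: lt_le_trans (_ : G x y <= _).
    by rewrite lt_neqAle eq_sym Gxy G0.
  by rewrite /d (big_rem y) //= lerDl sumr_ge0.
have pt x y : x \in s -> y \in s ->
    l ^+ 2 * (3 * G x y - G x y * (l / d x) - G x y * (l / d y)) <=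
    d x * d y * G x y.
  move=> xs ys; have [->|Gxy] := eqVneq (G x y) 0.
    by rewrite !(mulr0, mul0r) !subr0 mulr0.
  have dx := dpos _ _ xs ys Gxy; rewrite GC in Gxy.
  have dy := dpos _ _ ys xs Gxy.
  by have := ler_wpM2r (G0 x y) (AMGM3_inv dx dy l0); lra.
have half : \sum_(x <- s) \sum_(y <- s) G x y * (l / d x) <= m.
  have -> : m = \sum_(x <- s) l.
    rewrite big_const_seq count_predT iter_addr_0 -[RHS]mulr_natr.
    by rewrite /l divfK ?gt_eqF.
  apply: ler_sum => x _; rewrite -mulr_suml -/(d x).
  (* A vertex of degree zero contributes [0] rather than [l], hence only an inequality. *)
  have [->|dx] := eqVneq (d x) 0; first by rewrite mul0r ltW.
  by rewrite mulrC divfK.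
have half2 : \sum_(x <- s) \sum_(y <- s) G x y * (l / d y) <= m.
  rewrite exchange_big /=; under eq_bigr => y _ do
    under eq_bigr => x _ do rewrite GC.
  exact: half.
have key : l ^+ 2 * (3 * m - m - m) <= W.
  apply: le_trans (_ : l ^+ 2 * (3 * m -
      \sum_(x <- s) \sum_(y <- s) G x y * (l / d x) -
      \sum_(x <- s) \sum_(y <- s) G x y * (l / d y)) <= _).
    by rewrite ler_wpM2l ?exprn_ge0 ?(ltW l0) // lerB // lerB.
  rewrite /m mulr_sumr -!sumrB mulr_sumr big_seq /W [leRHS]big_seq.
  apply: ler_sum => x xs; rewrite mulr_sumr -!sumrB mulr_sumr big_seq [leRHS]big_seq.
  by apply: ler_sum => y ys; apply: pt.
have -> : m ^+ 3 = (size s)%:R ^+ 2 * (l ^+ 2 * (3 * m - m - m)).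
  by rewrite /l; field; rewrite gt_eqF.
by rewrite ler_wpM2l ?exprn_ge0.
Qed.

(** * Ratios, and the energy as a sum over triangles *)

Definition ratios (R : fieldType) (D : {fset R}) : {fset R} :=
  [fset x / y | x in D, y in D].

Lemma mem_ratios (R : fieldType) (D : {fset R}) (x y : R) :
  x \in D -> y \in D -> x / y \in ratios D.
Proof. by move=> xD yD; apply/imfset2P; exists x => //; exists y. Qed.

Lemma ratiosP (R : fieldType) (D : {fset R}) (u : R) : u \in ratios D ->
  exists x y, [/\ x \in D, y \in D & u = x / y].
Proof. by case/imfset2P => x /= xD [y /= yD ->]; exists x, y. Qed.

Lemma ratios_neq0 (R : fieldType) (D : {fset R}) (u : R) :
  0 \notin D -> u \in ratios D -> u != 0.
Proof.
move=> D0 /ratiosP[x [y [xD yD ->]]].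
by rewrite mulf_neq0 ?invr_eq0 //; apply: contraNneq D0 => <-.
Qed.

Lemma sum_ratio (R : fieldType) (S : comPzRingType) (D U : {fset R}) (y : R)
    (f : R -> S) : y != 0 -> {in D, forall x, x / y \in U} ->
  \sum_(x <- D) f (x / y) = \sum_(u <- U) (u * y \in D)%:R * f u.
Proof.
move=> y0 DU; rewrite -(big_map (fun x => x / y) xpredT f).
under [RHS]eq_bigr => u _ do rewrite mulr_natl mulrb.
rewrite -big_mkcond -[RHS]big_filter; apply: perm_big; apply: uniq_perm.
- rewrite map_inj_uniq ?fset_uniq //; apply: mulIf; by rewrite invr_eq0.
- exact/filter_uniq/fset_uniq.
move=> u; rewrite mem_filter; apply/mapP/andP => [[x xD ->]|[uD uU]].
  by rewrite divfK // DU.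
by exists (u * y); rewrite // mulfK.
Qed.

Lemma rep_le_inv (R : fieldType) (D : {fset R}) (u : R) :
  0 \notin D -> (rep D D u <= rep D D u^-1)%N.
Proof.
move=> D0; have [->|u0] := eqVneq u 0; first by rewrite invr0.
rewrite /rep !sum_nat_bool -!size_filter -(size_map (fun p => u * p)).
apply: uniq_leq_size.
  by rewrite map_inj_uniq ?filter_uniq ?fset_uniq //; apply: mulfI.
move=> _ /mapP[p + ->]; rewrite !mem_filter => /andP[upD pD].
by rewrite mulKf // pD.
Qed.

Lemma repV (R : fieldType) (D : {fset R}) (u : R) :
  0 \notin D -> rep D D u^-1 = rep D D u.
Proof.
move=> D0; apply/eqP; rewrite eqn_leq rep_le_inv // andbT.
by rewrite -[X in (_ <= rep _ _ X)%N]invrK rep_le_inv.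
Qed.

Lemma rep_natr (R : fieldType) (S : pzRingType) (D P : {fset R}) (x : R) :
  (rep D P x)%:R = \sum_(p <- P) (x * p \in D)%:R :> S.
Proof. by rewrite /rep natr_sum. Qed.

(** Substituting [e = p / b] for a solution [p] turns the count into an inner product of indicators,
    so [rep D D (a / b)] is a Gram matrix in [a] and [b]. *)
Lemma rep_div (R : fieldType) (S : comPzRingType) (D V : {fset R}) (a b : R) :
  b != 0 -> {in D, forall d, d / b \in V} ->
  (rep D D (a / b))%:R =
  \sum_(e <- V) (e * a \in D)%:R * (e * b \in D)%:R :> S.
Proof.
move=> b0 DV; under [RHS]eq_bigr => e _ do rewrite mulrC.
rewrite -(sum_ratio (fun e => (e * a \in D)%:R) b0 DV) rep_natr.
by apply: eq_bigr => d _; congr ((_ \in D)%:R); ring.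
Qed.

Lemma sum_sum_ratio (R : fieldType) (S : comPzRingType) (D : {fset R})
    (f : R -> S) : 0 \notin D ->
  \sum_(x <- D) \sum_(y <- D) f (y / x) =
  \sum_(u <- ratios D) (rep D D u)%:R * f u.
Proof.
move=> D0.
have e x : x \in D -> \sum_(y <- D) f (y / x) =
    \sum_(u <- ratios D) (u * x \in D)%:R * f u.
  move=> xD; apply: sum_ratio => [|y yD]; last exact: mem_ratios.
  by apply: contraNneq D0 => <-.
rewrite (eq_big_seq _ e) exchange_big /=; apply: eq_bigr => u _.
by rewrite -mulr_suml rep_natr.
Qed.

(* The kernel [rep D D (y / y')] on [D] is a Gram matrix which dominates
   [g (y / y')], so testing it against [d y = \sum_x g (y / x)] bounds the
   left-hand side below by the number of weighted three-step walks. *)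
Lemma energy_le_triangles (R : realType) (D : {fset R}) (g : R -> R) :
  0 \notin D -> (forall u, 0 <= g u) -> (forall u, g u^-1 = g u) ->
  (forall u, g u <= (rep D D u)%:R) ->
  (\sum_(u <- ratios D) (rep D D u)%:R * g u) ^+ 3 <=
  #|` D|%:R ^+ 3 * \sum_(x <- D) \sum_(y <- D) \sum_(z <- D)
    g (y / x) * g (z / x) * (rep D D (y / z))%:R.
Proof.
move=> D0 g0 gV gr.
have Dn0 x : x \in D -> x != 0 by move=> xD; apply: contraNneq D0 => <-.
have gram y z : z \in D -> (rep D D (y / z))%:R =
    \sum_(e <- ratios D) (e * y \in D)%:R * (e * z \in D)%:R :> R.
  by move=> zD; apply: rep_div (Dn0 _ zD) _ => d dD; apply: mem_ratios.
pose d y := \sum_(x <- D) g (y / x).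
have d0 y : 0 <= d y by apply: sumr_ge0.
have gC x y : g (y / x) = g (x / y) by rewrite -gV invf_div.
rewrite -(sum_sum_ratio _ D0).
have := @three_walks _ _ D (fun x y => g (y / x)) (fun x y => g0 _) gC.
move=> /le_trans; apply.
rewrite [X in _ <= X * _]exprSr -[leRHS]mulrA.
rewrite ler_wpM2l ?exprn_ge0 //.
have eL : \sum_(x <- D) \sum_(y <- D) \sum_(z <- D)
    g (y / x) * g (z / x) * (rep D D (y / z))%:R =
  \sum_(x <- D) \sum_(e <- ratios D)
    (\sum_(y <- D) g (y / x) * (e * y \in D)%:R) ^+ 2.
  apply: eq_bigr => x _; rewrite -sum_gram; apply: eq_bigr => y _.
  by apply: eq_big_seq => z zD; rewrite gram.
(* Here the middle factor [g] is replaced by the larger [rep D D], whose Gram form turns the walks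
   into squares. *)
have eR : \sum_(x <- D) \sum_(y <- D) (\sum_(z <- D) g (z / x)) *
    (\sum_(z <- D) g (z / y)) * g (y / x) <=
  \sum_(e <- ratios D) (\sum_(y <- D) d y * (e * y \in D)%:R) ^+ 2.
  rewrite -sum_gram; apply: ler_sum => x _; rewrite big_seq [leRHS]big_seq.
  apply: ler_sum => y yD; rewrite -gram //.
  have e z : \sum_(w <- D) g (w / z) = d z by apply: eq_bigr => w _.
  by rewrite !e gC ler_wpM2l ?mulr_ge0.
apply: le_trans eR _; rewrite eL [X in _ * X]exchange_big mulr_sumr /=.
apply: ler_sum => e _.
(* Cauchy-Schwarz over [x] against the constant [1] costs the third factor [|D|]; the other two come
   from [three_walks]. *)
have -> : \sum_(y <- D) d y * (e * y \in D)%:R =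
    \sum_(x <- D) 1 * \sum_(y <- D) g (y / x) * (e * y \in D)%:R.
  under [RHS]eq_bigr => x _ do rewrite mul1r.
  by rewrite exchange_big; apply: eq_bigr => y _; rewrite /d mulr_suml.
apply: le_trans (Cauchy_Schwarz_sum _ _ _) _.
have -> // : \sum_(x <- D) 1 ^+ 2 = #|` D|%:R :> R.
by rewrite -sum1_size natr_sum; apply: eq_bigr => x _; rewrite expr1n.
Qed.

(** With [a = y / x] and [b = z / x] one has [y / z = a / b], so the triple sum runs over [(a, b)]
    with multiplicity the number of [x]. After Cauchy-Schwarz, [sum_gram_sqr] turns the squared
    multiplicities into the third moment. *)
Lemma triangles_le (R : realType) (D : {fset R}) (g : R -> R) :
  0 \notin D ->
  (\sum_(x <- D) \sum_(y <- D) \sum_(z <- D)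
    g (y / x) * g (z / x) * (rep D D (y / z))%:R) ^+ 2 <=
  (\sum_(u <- ratios D) (rep D D u)%:R ^+ 3) *
  \sum_(a <- ratios D) \sum_(b <- ratios D)
    (g a * g b * (rep D D (a / b))%:R) ^+ 2.
Proof.
move=> D0.
have Dn0 x : x \in D -> x != 0 by move=> xD; apply: contraNneq D0 => <-.
pose r u : R := (rep D D u)%:R; pose U := ratios D.
pose chi x a : R := (a * x \in D)%:R.
have -> : \sum_(x <- D) \sum_(y <- D) \sum_(z <- D)
    g (y / x) * g (z / x) * (rep D D (y / z))%:R =
  \sum_(a <- U) \sum_(b <- U) (\sum_(x <- D) chi x a * chi x b) *
    (g a * g b * r (a / b)).
  transitivity (\sum_(x <- D) \sum_(a <- U) \sum_(b <- U)
    chi x a * chi x b * (g a * g b * r (a / b))).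
    apply: eq_big_seq => x xD; have x0 := Dn0 _ xD.
    have DU : {in D, forall y, y / x \in U} by move=> y yD; apply: mem_ratios.
    transitivity (\sum_(y <- D) \sum_(b <- U) chi x b *
        (g (y / x) * g b * r (y / x / b))).
      apply: eq_bigr => y _.
      rewrite -(sum_ratio (fun b => g (y / x) * g b * r (y / x / b)) x0 DU).
      by apply: eq_bigr => z _; rewrite /r invf_div mulrA divfK.
    rewrite (sum_ratio
      (fun a => \sum_(b <- U) chi x b * (g a * g b * r (a / b))) x0 DU).
    apply: eq_bigr => a _; rewrite mulr_sumr; apply: eq_bigr => b _.
    by rewrite -[RHS]mulrA.
  rewrite exchange_big; apply: eq_bigr => a _.
  rewrite exchange_big; apply: eq_bigr => b _.
  by rewrite mulr_suml.
apply: le_trans (Cauchy_Schwarz_sum2 _ _ _ _) _.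
rewrite ler_wpM2r //.
  by apply: sumr_ge0 => a _; apply: sumr_ge0 => b _; apply: sqr_ge0.
rewrite sum_gram_sqr.
have -> : \sum_(u <- U) r u ^+ 3 = \sum_(x <- D) \sum_(y <- D) r (y / x) ^+ 2.
  rewrite (sum_sum_ratio (fun u => r u ^+ 2) D0).
  by apply: eq_bigr => u _; rewrite exprS.
rewrite big_seq [leRHS]big_seq; apply: ler_sum => x xD.
apply: ler_sum => y _.
have -> // : r (y / x) = \sum_(e <- U) chi x e * chi y e.
under eq_bigr => e _ do rewrite mulrC.
by apply: rep_div (Dn0 _ xD) _ => d dD; apply: mem_ratios.
Qed.

(** * Trading the smallest of three factors for fourth roots *)

Definition root4 (R : rcfType) (x : R) : R := Num.sqrt (Num.sqrt x).

Lemma root4_ge0 (R : rcfType) (x : R) : 0 <= root4 x.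
Proof. exact: sqrtr_ge0. Qed.

Lemma sqr_root4 (R : rcfType) (x : R) : root4 x ^+ 2 = Num.sqrt x.
Proof. by rewrite sqr_sqrtr // sqrtr_ge0. Qed.

Lemma ler_root4 (R : rcfType) (x y : R) : x <= y -> root4 x <= root4 y.
Proof. by move=> xy; rewrite !ler_wsqrtr. Qed.

(** For [x >= 0] this is the power [9/4]: the square of a factor times the fourth root it receives
    in exchange for the smallest one. *)
Definition weight (R : rcfType) (x : R) : R := x ^+ 2 * root4 x.

Lemma weight_ge0 (R : rcfType) (x : R) : 0 <= weight x.
Proof. by rewrite mulr_ge0 ?sqr_ge0 ?root4_ge0. Qed.

(** One of the two factors [p] is split as [p ^ (1/2) p ^ (1/4) p ^ (1/4)], and the pieces are
    bounded by the powers of [T], [q] and [s]. *)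
Lemma sqr_mul3_le_min (R : rcfType) (T p q s : R) :
  0 <= p -> p <= T -> p <= q -> p <= s ->
  p ^+ 2 * q ^+ 2 * s ^+ 2 <= Num.sqrt T * (p * weight q * weight s).
Proof.
move=> p0 pT pq ps.
have h : p <= Num.sqrt T * (root4 q * root4 s).
  rewrite -{1}(sqr_sqrtr p0) expr2 -{2}sqr_root4.
  apply: ler_pM; rewrite ?sqrtr_ge0 ?sqr_ge0 ?ler_wsqrtr //.
  by rewrite expr2 ler_pM ?root4_ge0 ?ler_root4.
have a0 : 0 <= p * q ^+ 2 * s ^+ 2 by rewrite ?(sqr_ge0, mulr_ge0).
have := ler_wpM2l a0 h; rewrite /weight.
set lhs := (X in X <= _ -> _); set rhs := (X in _ <= X -> _).
have -> : lhs = p ^+ 2 * q ^+ 2 * s ^+ 2 by rewrite /lhs; ring.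
by have -> : rhs = Num.sqrt T * (p * (q ^+ 2 * root4 q) * (s ^+ 2 * root4 s))
  by rewrite /rhs; ring.
Qed.

(** One term for each possible smallest factor; if that is [m], then [m <= x <= T]. *)
Lemma sqr_mul3_le (R : rcfType) (T x y m : R) :
  0 <= x -> 0 <= y -> 0 <= m -> x <= T -> y <= T ->
  (x * y * m) ^+ 2 <= Num.sqrt T *
    (m * weight x * weight y + y * weight x * weight m + x * weight y * weight m).
Proof.
move=> x0 y0 m0 xT yT; rewrite !mulrDr !exprMn.
have p1 : 0 <= Num.sqrt T * (m * weight x * weight y).
  by rewrite !mulr_ge0 ?sqrtr_ge0 ?weight_ge0.
have p2 : 0 <= Num.sqrt T * (y * weight x * weight m).
  by rewrite !mulr_ge0 ?sqrtr_ge0 ?weight_ge0.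
have p3 : 0 <= Num.sqrt T * (x * weight y * weight m).
  by rewrite !mulr_ge0 ?sqrtr_ge0 ?weight_ge0.
have [mx|/ltW xm] := leP m x; have [my|/ltW ym] := leP m y;
  have [xy|/ltW yx] := leP x y.
- by have := sqr_mul3_le_min m0 (le_trans mx xT) mx my; lra.
- by have := sqr_mul3_le_min m0 (le_trans mx xT) mx my; lra.
- by have := sqr_mul3_le_min y0 yT (le_trans ym mx) ym; lra.
- by have := sqr_mul3_le_min y0 yT yx ym; lra.
- by have := sqr_mul3_le_min x0 xT xy xm; lra.
- by have := sqr_mul3_le_min x0 xT (le_trans xm my) xm; lra.
- by have := sqr_mul3_le_min x0 xT xy xm; lra.
- by have := sqr_mul3_le_min y0 yT yx ym; lra.
Qed.

(** A division-free form of the monotonicity of [x ^ (-3/4)]; in terms of fourth roots it compares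
    two cubes. *)
Lemma root4_concave (R : rcfType) (x y : R) : 0 <= x -> x <= y ->
  x * root4 y <= y * root4 x.
Proof.
move=> x0 xy; have y0 := le_trans x0 xy.
have fx := root4_ge0 x; have fxy := ler_root4 xy.
have e (z : R) : 0 <= z -> z = root4 z ^+ 4.
  by move=> z0; rewrite (exprM _ 2 2) sqr_root4 sqr_sqrtr.
rewrite {1}(e x x0) {2}(e y y0).
have -> : root4 x ^+ 4 * root4 y = root4 x * root4 y * root4 x ^+ 3 by ring.
have -> : root4 y ^+ 4 * root4 x = root4 x * root4 y * root4 y ^+ 3 by ring.
by rewrite ler_wpM2l ?mulr_ge0 ?root4_ge0 ?lerXn2r ?nnegrE ?root4_ge0.
Qed.

(** After multiplication by [r], the cube is cut into layers [t ^ 2], and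
    [t * root4 r <= r * root4 t] moves the fourth root into each layer. *)
Lemma weight_le_layers (R : rcfType) (r : nat) :
  weight (r%:R : R) <= 3 * \sum_(1 <= t < r.+1) t%:R * root4 t%:R.
Proof.
have [->|r0] := posnP r; first by rewrite /weight expr0n mul0r big_geq ?mulr0.
have rp : 0 < r%:R :> R by rewrite ltr0n.
rewrite -(ler_pM2l rp) /weight mulrA -exprS.
apply: le_trans (_ : (3 * \sum_(1 <= t < r.+1) t ^ 2)%N%:R * root4 r%:R <= _).
  by rewrite ler_wpM2r ?root4_ge0 // -natrX ler_nat cube_le_sum_squares.
rewrite natrM natr_sum mulrCA -mulrA ler_wpM2l // mulr_suml mulr_sumr.
apply: ler_sum_nat => t /andP[_ tr].
have := root4_concave (ler0n R t) (_ : t%:R <= r%:R :> R).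
rewrite ler_nat -ltnS => /(_ tr) /(ler_wpM2l (ler0n R t)).
by rewrite natrX expr2 -mulrA [leRHS]mulrCA.
Qed.

(** The substitution [c = a / b] is an involution where both [b] and [a / b] are ratios; elsewhere
    the left terms vanish and the right ones are nonnegative. *)
Lemma sum_swap_ratio (R : realType) (D : {fset R}) (a : R) (f h : R -> R) :
  0 \notin D -> a != 0 -> (forall u, 0 <= f u) -> (forall u, 0 <= h u) ->
  (forall u, u \notin ratios D -> h u = 0) ->
  \sum_(b <- ratios D) f b * h (a / b) <= \sum_(c <- ratios D) f (a / c) * h c.
Proof.
move=> D0 a0 f0 h0 hU; set U := ratios D.
rewrite (bigID (fun b => a / b \in U)) /= [X in _ + X]big1 ?addr0; last first.
  by move=> b abU; rewrite (hU _ abU) mulr0.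
rewrite [leRHS](bigID (fun c => a / c \in U)) /=.
apply: ler_wpDr; first by apply: sumr_ge0 => c _; rewrite mulr_ge0.
have aK b : b != 0 -> a / (a / b) = b.
  by move=> b0; rewrite invf_div mulrCA divff ?mulr1.
rewrite -big_filter -[leRHS]big_filter; set s := [seq _ <- _ | _].
have ss (b : R) : b \in s -> (b != 0) && (a / b \in s).
  rewrite !mem_filter => /andP[abU bU].
  by have b0 := ratios_neq0 D0 bU; rewrite b0 abU aK // bU.
have -> : \sum_(b <- s) f b * h (a / b) =
    \sum_(b <- map (fun b => a / b) s) f (a / b) * h b.
  rewrite big_map; apply: eq_big_seq => b /ss/andP[b0 _].
  by rewrite aK.
rewrite (perm_big s) //; apply: uniq_perm.
- rewrite map_inj_in_uniq ?filter_uniq ?fset_uniq //.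
  move=> b c /ss/andP[b0 _] /ss/andP[c0 _] e.
  by rewrite -(aK b) // e aK.
- exact/filter_uniq/fset_uniq.
move=> c; apply/mapP/idP => [[b /ss/andP[_ ?] ->] //|/ss/andP[c0 acs]].
by exists (a / c); rewrite ?aK.
Qed.

Lemma rep_notin_ratios (R : fieldType) (D : {fset R}) (u : R) : 0 \notin D ->
  u \notin ratios D -> rep D D u = 0%N.
Proof.
move=> D0 uU; apply: big1_seq => d /andP[_ dD]; apply/eqP; rewrite eqb0.
apply: contra uU => udD; rewrite -[u](@mulfK _ d) ?mem_ratios //.
by apply: contraNneq D0 => <-.
Qed.

(** [sqr_mul3_le] gives three sums; replacing [b] by [a / b], and using the symmetry of [rep D D]
    under inversion, bounds each by the same sum. *)
Lemma triangle_weights_le (R : realType) (D : {fset R}) (T : R) (g : R -> R) :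
  0 \notin D -> (forall u, 0 <= g u) -> (forall u, g u <= T) ->
  (forall u, g u <= (rep D D u)%:R) ->
  \sum_(a <- ratios D) \sum_(b <- ratios D)
    (g a * g b * (rep D D (a / b))%:R) ^+ 2 <=
  3 * Num.sqrt T * \sum_(a <- ratios D) \sum_(b <- ratios D)
    weight (rep D D a)%:R * weight (rep D D b)%:R * (rep D D (a / b))%:R.
Proof.
move=> D0 g0 gT gr; set U := ratios D.
pose r u : R := (rep D D u)%:R; pose w u := weight (r u).
have r0 u : 0 <= r u by apply: ler0n.
have w0 u : 0 <= w u by apply: weight_ge0.
have gw u : weight (g u) <= w u.
  by apply: ler_pM; rewrite ?sqr_ge0 ?root4_ge0 ?ler_root4 ?lerXn2r ?nnegrE.
have rV u : r u^-1 = r u by rewrite /r repV.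
pose Z := \sum_(a <- U) \sum_(b <- U) w a * w b * r (a / b).
rewrite -[X in _ <= _ * X]/Z.
have swap : \sum_(a <- U) \sum_(b <- U) r b * w a * w (a / b) <= Z.
  rewrite big_seq /Z [leRHS]big_seq; apply: ler_sum => a aU.
  apply: le_trans (_ : w a * \sum_(b <- U) r b * w (a / b) <= _).
    by rewrite mulr_sumr; apply: ler_sum => b _; rewrite [leRHS]mulrCA [leRHS]mulrA.
  apply: le_trans (_ : w a * \sum_(b <- U) r (a / b) * w b <= _).
    rewrite ler_wpM2l // sum_swap_ratio // ?(ratios_neq0 D0 aU) // => u uU.
    by rewrite /w /r rep_notin_ratios // /weight expr0n mul0r.
  by rewrite mulr_sumr; apply: ler_sum => b _; rewrite [leLHS]mulrA [leLHS]mulrAC.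
have swap2 : \sum_(a <- U) \sum_(b <- U) r a * w b * w (a / b) <= Z.
  rewrite exchange_big /=; apply: le_trans swap; apply: ler_sum => b _.
  by apply: ler_sum => a _; rewrite /w -(rV (a / b)) invf_div.
have pt a b : (g a * g b * r (a / b)) ^+ 2 <= Num.sqrt T *
    (w a * w b * r (a / b) + r b * w a * w (a / b) + r a * w b * w (a / b)).
  apply: le_trans (sqr_mul3_le (g0 a) (g0 b) (r0 _) (gT a) (gT b)) _.
  rewrite ler_wpM2l ?sqrtr_ge0 // !lerD //.
  - by rewrite -mulrA mulrC ler_wpM2r // ler_pM ?weight_ge0.
  - by rewrite ler_wpM2r ?weight_ge0 // ler_pM ?weight_ge0.
  - by rewrite ler_wpM2r ?weight_ge0 // ler_pM ?weight_ge0.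
apply: le_trans (_ : Num.sqrt T * (Z +
   \sum_(a <- U) \sum_(b <- U) r b * w a * w (a / b)
   + \sum_(a <- U) \sum_(b <- U) r a * w b * w (a / b)) <= _).
  rewrite -!big_split mulr_sumr; apply: ler_sum => a _ /=.
  by rewrite -!big_split mulr_sumr; apply: ler_sum => b _ /=; apply: pt.
have := ler_wpM2l (sqrtr_ge0 T) swap; have := ler_wpM2l (sqrtr_ge0 T) swap2.
lra.
Qed.

(** The left side is a Gram form, a sum of squares over [e]. Cutting the weights into level sets
    [P t] reduces it to second moments of [rho t], which Cauchy-Schwarz interpolates between the
    first moment and the cubic bound. *)
Lemma weighted_energy_le (R : realType) (D : {fset R}) (B : R) :
  0 \notin D ->
  (forall P X : {fset R},
    \sum_(x <- X) (rep D P x)%:R ^+ 3 <= B * #|` P|%:R ^+ 2) ->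
  \sum_(a <- ratios D) \sum_(b <- ratios D)
    weight (rep D D a)%:R * weight (rep D D b)%:R * (rep D D (a / b))%:R <=
  9 * harmonic_sum R #|` D| ^+ 2 * (Num.sqrt #|` D|%:R * #|` D|%:R ^+ 3 * B ^+ 2).
Proof.
move=> D0 hB; set U := ratios D; set N := #|` D|.
have B0 : 0 <= B.
  by have := hB [fset 0] fset0; rewrite big_seq_fset0 cardfs1 expr1n mulr1.
pose V := [fset d / u | d in D, u in U].
pose w u : R := weight (rep D D u)%:R.
pose P t := [fset u in U | (t <= rep D D u)%N].
pose rho t e : R := (rep D (P t) e)%:R.
pose c (t : nat) : R := t%:R * root4 t%:R.
have c0 t : 0 <= c t by rewrite mulr_ge0 ?root4_ge0.
have -> : \sum_(a <- U) \sum_(b <- U)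
    weight (rep D D a)%:R * weight (rep D D b)%:R * (rep D D (a / b))%:R =
    \sum_(e <- V) (\sum_(a <- U) w a * (e * a \in D)%:R) ^+ 2.
  rewrite -sum_gram; apply: eq_bigr => a _; apply: eq_big_seq => b bU.
  rewrite (@rep_div _ _ D V a b) // ?(ratios_neq0 D0 bU) // => d dD.
  by apply/imfset2P; exists d => //; exists b.
have inner e : \sum_(a <- U) w a * (e * a \in D)%:R <=
    3 * \sum_(1 <= t < N.+1) c t * rho t e.
  under eq_bigr => a _ do rewrite mulr_natr mulrb.
  rewrite -big_mkcond -big_filter.
  apply: le_trans (ler_sum _ (fun a _ => weight_le_layers R (rep D D a))) _.
  rewrite -mulr_sumr (@sum_count_layers _ _ _ _ N); last first.
    by move=> a _; apply: rep_le_card.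
  rewrite ler_wpM2l //; apply: ler_sum => t _; rewrite /c ler_wpM2l ?c0 //.
  rewrite /rho /rep (perm_big _ (perm_fset_filter _ _)) /= sum_nat_bool.
  by rewrite !count_filter; under eq_count => a do rewrite /= andbC.
have cardP t : t%:R ^+ 3 * #|` P t|%:R <= B * N%:R ^+ 2.
  apply: le_trans (hB D U).
  rewrite card_fset_filter -sum_nat_bool natr_sum mulr_sumr.
  apply: ler_sum => u _; case: leqP => tr; last by rewrite mulr0 exprn_ge0.
  by rewrite mulr1 lerXn2r ?nnegrE ?ler_nat.
(* The squared second moment is at most [N B |P t| ^ 3]; inserting [t ^ 3 |P t| <= B N ^ 2] leaves a
   factor [1 / t], the source of one harmonic sum. *)
have sqr_sum t : (1 <= t)%N -> t%:R ^+ 3 * Num.sqrt t%:R *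
    \sum_(e <- V) rho t e ^+ 2 <=
    Num.sqrt N%:R * N%:R ^+ 3 * B ^+ 2 * t%:R^-1.
  move=> t1; have tp : 0 < t%:R :> R by rewrite ltr0n.
  rewrite ler_pdivlMr //; set S := \sum_(e <- V) _.
  have S0 : 0 <= S by apply: sumr_ge0 => e _; apply: sqr_ge0.
  have SS : S ^+ 2 <= N%:R * #|` P t|%:R * (B * #|` P t|%:R ^+ 2).
    have -> : S = \sum_(e <- V) Num.sqrt (rho t e) * (Num.sqrt (rho t e) * rho t e).
      by apply: eq_bigr => e _; rewrite mulrA -expr2 sqr_sqrtr ?ler0n // expr2.
    apply: le_trans (Cauchy_Schwarz_sum _ _ _) _.
    have -> : \sum_(e <- V) Num.sqrt (rho t e) ^+ 2 = \sum_(e <- V) rho t e.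
      by apply: eq_bigr => e _; rewrite sqr_sqrtr ?ler0n.
    have -> : \sum_(e <- V) (Num.sqrt (rho t e) * rho t e) ^+ 2 =
        \sum_(e <- V) rho t e ^+ 3.
      by apply: eq_bigr => e _; rewrite exprMn sqr_sqrtr ?ler0n // -exprS.
    apply: ler_pM; rewrite ?sumr_ge0 // ?hB //.
      by move=> e _; rewrite exprn_ge0 ?ler0n.
    by rewrite -natr_sum -natrM ler_nat sum_rep_le.
  rewrite -ler_sqr ?nnegrE; last first.
  - by rewrite ?(sqrtr_ge0, exprn_ge0, mulr_ge0, ler0n).
  - by rewrite ?(sqrtr_ge0, exprn_ge0, mulr_ge0, ler0n).
  have -> : (t%:R ^+ 3 * Num.sqrt t%:R * S * t%:R) ^+ 2 =
      t%:R ^+ 8 * Num.sqrt t%:R ^+ 2 * S ^+ 2 by ring.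
  have -> : (Num.sqrt N%:R * N%:R ^+ 3 * B ^+ 2) ^+ 2 =
      Num.sqrt N%:R ^+ 2 * (N%:R ^+ 6 * B ^+ 4) by ring.
  rewrite !sqr_sqrtr ?ler0n // -exprSr.
  apply: le_trans (ler_wpM2l (exprn_ge0 _ (ler0n _ _)) SS) _.
  have -> : t%:R ^+ 9 * (N%:R * #|` P t|%:R * (B * #|` P t|%:R ^+ 2)) =
      N%:R * B * (t%:R ^+ 3 * #|` P t|%:R) ^+ 3 by ring.
  have -> : N%:R * (N%:R ^+ 6 * B ^+ 4) = N%:R * B * (B * N%:R ^+ 2) ^+ 3 by ring.
  rewrite ler_wpM2l ?mulr_ge0 //.
  have p0 : 0 <= t%:R ^+ 3 * #|` P t|%:R :> R by rewrite mulr_ge0 ?exprn_ge0.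
  by rewrite lerXn2r ?nnegrE ?cardP // (le_trans p0 (cardP t)).
have rho0 t e : 0 <= rho t e by apply: ler0n.
(* As [c t = t ^ (5/4)], splitting off [t ^ (-1/2)] produces the other harmonic sum and the power
   [t ^ (7/2)] that [sqr_sum] handles. *)
have weighted e : (\sum_(1 <= t < N.+1) c t * rho t e) ^+ 2 <=
    harmonic_sum R N * \sum_(1 <= t < N.+1) t%:R ^+ 3 * Num.sqrt t%:R * rho t e ^+ 2.
  have -> : \sum_(1 <= t < N.+1) c t * rho t e = \sum_(1 <= t < N.+1)
      (Num.sqrt t%:R)^-1 * (Num.sqrt t%:R * c t * rho t e).
    apply: eq_big_nat => t /andP[t1 _].
    by rewrite -!mulrA mulKf // gt_eqF // sqrtr_gt0 ltr0n.
  apply: le_trans (Cauchy_Schwarz_sum _ _ _) _.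
  have -> : \sum_(1 <= t < N.+1) (Num.sqrt t%:R)^-1 ^+ 2 = harmonic_sum R N.
    by apply: eq_big_nat => t _; rewrite exprVn sqr_sqrtr.
  rewrite le_eqVlt; apply/orP; left; apply/eqP; congr (_ * _).
  apply: eq_bigr => t _; rewrite !exprMn sqr_root4 sqr_sqrtr //; ring.
have H0 : 0 <= harmonic_sum R N by apply: sumr_ge0 => t _; rewrite invr_ge0.
apply: le_trans (_ : \sum_(e <- V) 9 * (harmonic_sum R N *
    \sum_(1 <= t < N.+1) t%:R ^+ 3 * Num.sqrt t%:R * rho t e ^+ 2) <= _).
  apply: ler_sum => e _.
  apply: le_trans (_ : (3 * \sum_(1 <= t < N.+1) c t * rho t e) ^+ 2 <= _).
    rewrite lerXn2r ?nnegrE ?inner //.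
      by apply: sumr_ge0 => a _; rewrite mulr_ge0 ?weight_ge0.
    by rewrite mulr_ge0 // sumr_ge0 // => t _; rewrite mulr_ge0.
  by rewrite exprMn -natrX ler_wpM2l.
rewrite -!mulr_sumr -mulrA expr2 -mulrA !ler_wpM2l //.
rewrite exchange_big /= [leRHS]mulrC mulr_sumr; apply: ler_sum_nat => t /andP[t1 _].
by rewrite -mulr_sumr sqr_sum.
Qed.

(** * Truncation at level [T] and choice of parameters *)

Lemma low_energy_le (R : realType) (D : {fset R}) (B T : R) :
  0 \notin D -> 0 <= T ->
  (forall P X : {fset R},
    \sum_(x <- X) (rep D P x)%:R ^+ 3 <= B * #|` P|%:R ^+ 2) ->
  (\sum_(u <- ratios D | (rep D D u)%:R <= T) (rep D D u)%:R ^+ 2) ^+ 6 <=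
  27 * Num.sqrt T * Num.sqrt #|` D|%:R * #|` D|%:R ^+ 11 * B ^+ 3 *
  harmonic_sum R #|` D| ^+ 2.
Proof.
move=> D0 T0 hB; set N := #|` D|.
pose r u : R := (rep D D u)%:R; pose g u := if r u <= T then r u else 0.
have r0 u : 0 <= r u by apply: ler0n.
have g0 u : 0 <= g u by rewrite /g; case: ifP.
have gT u : g u <= T by rewrite /g; case: ifP.
have gr u : g u <= r u by rewrite /g; case: ifP.
have gV u : g u^-1 = g u by rewrite /g /r repV.
have B0 : 0 <= B.
  by have := hB [fset 0] fset0; rewrite big_seq_fset0 cardfs1 expr1n mulr1.
have -> : \sum_(u <- ratios D | r u <= T) r u ^+ 2 =
    \sum_(u <- ratios D) r u * g u.
  rewrite big_mkcond; apply: eq_bigr => u _; rewrite /g.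
  by case: ifP; rewrite ?mulr0 // expr2.
set E := \sum_(u <- _) _.
have E0 : 0 <= E by apply: sumr_ge0 => u _; rewrite mulr_ge0.
have h1 := energy_le_triangles D0 g0 gV gr.
have h2 := triangles_le g D0.
have h3 := triangle_weights_le D0 g0 gT gr.
have h4 := weighted_energy_le D0 hB.
move: h1 h2; rewrite -/E -/N; set S3 := (\sum_(x <- D) _) => h1 h2.
(* Squaring matches the cube of [E] with the square of the triangle sum. The powers of [N] then add
   up to [6 + 2 + 3 = 11], apart from the square root, and [27 = 3 * 9]. *)
have h6 : E ^+ 6 <= (N%:R ^+ 3 * S3) ^+ 2.
  by rewrite (exprM E 3 2) lerXn2r ?nnegrE ?exprn_ge0 // (le_trans _ h1) ?exprn_ge0.
apply: le_trans h6 _; rewrite exprMn -exprM.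
have s0 : 0 <= 3 * Num.sqrt T by rewrite mulr_ge0 ?sqrtr_ge0.
have h5 := le_trans h3 (ler_wpM2l s0 h4).
have h7 : S3 ^+ 2 <= (B * N%:R ^+ 2) * (3 * Num.sqrt T *
    (9 * harmonic_sum R N ^+ 2 * (Num.sqrt N%:R * N%:R ^+ 3 * B ^+ 2))).
  apply: le_trans h2 _; apply: ler_pM => //.
  - by apply: sumr_ge0 => u _; rewrite exprn_ge0.
  - by apply: sumr_ge0 => a _; apply: sumr_ge0 => b _; apply: sqr_ge0.
have n0 : 0 <= N%:R ^+ 6 :> R by rewrite exprn_ge0.
apply: le_trans (ler_wpM2l n0 h7) _; rewrite le_eqVlt; apply/orP; left.
by apply/eqP; ring.
Qed.

(** Above the level [T] one has [r ^ 2 <= r ^ 3 / T], and the cubic bound applies with [P = D]. *)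
Lemma energy_le (R : realType) (D : {fset R}) (B T : R) :
  0 \notin D -> 0 < T ->
  (forall P X : {fset R},
    \sum_(x <- X) (rep D P x)%:R ^+ 3 <= B * #|` P|%:R ^+ 2) ->
  \sum_(u <- ratios D) (rep D D u)%:R ^+ 2 <=
  \sum_(u <- ratios D | (rep D D u)%:R <= T) (rep D D u)%:R ^+ 2 +
  B * #|` D|%:R ^+ 2 / T.
Proof.
move=> D0 T0 hB.
rewrite (bigID (fun u => (rep D D u)%:R <= T)) /= lerD2l ler_pdivlMr //.
apply: le_trans (hB D (ratios D)).
rewrite [leRHS](bigID (fun u => (rep D D u)%:R <= T)) /=.
apply: ler_wpDl; first by apply: sumr_ge0 => u _; rewrite exprn_ge0.
rewrite mulr_suml; apply: ler_sum => u; rewrite -ltNge => /ltW Tr.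
by rewrite [leRHS]exprSr ler_wpM2l ?sqr_ge0.
Qed.

Lemma harmonic_sum_le_log2 (R : realType) (n : nat) : (2 <= n)%N ->
  harmonic_sum R n <= 2 * log2 n%:R.
Proof.
move=> n2; have h k : harmonic_sum R k.+1 <= 1 + ln k.+1%:R.
  elim: k => [|k IH]; first by rewrite /harmonic_sum big_nat1 ln1 invr1 addr0.
  rewrite /harmonic_sum big_nat_recr //= -/(harmonic_sum R k.+1).
  have k1 : 0 < k.+1%:R :> R by rewrite ltr0n.
  have k2 : 0 < k.+2%:R :> R by rewrite ltr0n.
  have : ln (k.+1%:R / k.+2%:R : R) <= - k.+2%:R^-1.
    rewrite -ler_expR lnK ?posrE ?divr_gt0 //.
    apply: le_trans (expR_ge1Dx _).
    rewrite le_eqVlt; apply/orP; left; apply/eqP.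
    by move: k2; rewrite -[k.+2%:R]natr1 => k2; field; rewrite gt_eqF.
  rewrite ln_div ?posrE //; move: IH {k1 k2}.
  by move: (harmonic_sum R _) (ln _) (ln _) (_^-1) => x y z t; lra.
have ln2 : 0 < ln 2 :> R by rewrite ln_gt0 // ltr1n.
have ln21 : ln 2 <= 1 :> R.
  rewrite -ler_expR lnK ?posrE //; have := expR_ge1Dx (1 : R); lra.
have lnn : ln 2 <= ln n%:R :> R.
  by rewrite ler_ln ?posrE ?ltr0n ?ler_nat ?(leq_trans _ n2).
have := h n.-1; rewrite prednK ?(leq_trans _ n2) // => /le_trans; apply.
rewrite /log2 mulrA ler_pdivlMr //; nra.
Qed.

Lemma ge1_log2 (R : realType) (n : nat) : (2 <= n)%N -> 1 <= log2 (n%:R : R).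
Proof.
move=> n2; have ln2 : 0 < ln 2 :> R by rewrite ln_gt0 // ltr1n.
by rewrite ler_pdivlMr // mul1r ler_ln ?posrE ?ltr0n ?ler_nat ?(leq_trans _ n2).
Qed.

Lemma structured_energy_le (R : realType) (D K C : {fset R}) (c M : R)
    (n : nat) :
  0 \notin D -> 0 \notin K -> c != 0 ->
  {in K & D, forall k d, k * (d + c) \in C} ->
  (#|` D| <= n)%N -> (2 <= n)%N -> (n <= 2 * #|` K|)%N -> 1 <= M ->
  #|` C|%:R = M * n%:R ->
  \sum_(u <- ratios D) (rep D D u)%:R ^+ 2 <=
  1072 * (M `^ (14 / 13) * n%:R `^ (32 / 13) * log2 n%:R).
Proof.
move=> D0 K0 c0 KD Dn n2 nK M1 CM.
have M0 : 0 <= M := le_trans ler01 M1.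
(* These roots make every exponent an integer: [M = m ^ 13] and [n = v ^ 26]. *)
pose m := M `^ 13^-1; pose v : R := n%:R `^ 26^-1.
have m1 : 1 <= m by rewrite -(powRr0 M) ler_powR.
have m0 : 0 < m := lt_le_trans ltr01 m1.
have n1R : 1 <= n%:R :> R by rewrite ler1n (leq_trans _ n2).
have v1 : 1 <= v by rewrite -(powRr0 n%:R) ler_powR.
have v0 : 0 < v := lt_le_trans ltr01 v1.
have m0' := ltW m0; have v0' := ltW v0.
have mE k : M `^ (k%:R / 13) = m ^+ k.
  by rewrite mulrC powRrM powR_mulrn ?powR_ge0.
have vE k : n%:R `^ (k%:R / 26) = v ^+ k.
  by rewrite mulrC powRrM powR_mulrn ?powR_ge0.
have -> : M `^ (14 / 13) = m ^+ 14 by rewrite -mE.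
have -> : n%:R `^ (32 / 13) = v ^+ 64.
  by rewrite -vE; congr (_ `^ _); field.
have em : M = m ^+ 13 by rewrite -mE divff ?powRr1.
have ev : n%:R = v ^+ 26 by rewrite -vE divff ?powRr1.
set L := log2 _; have L1 : 1 <= L := ge1_log2 R n2.
have L0 : 0 <= L := le_trans ler01 L1.
have HL : harmonic_sum R n <= 2 * L := harmonic_sum_le_log2 R n2.
have H0 k : 0 <= harmonic_sum R k by apply: sumr_ge0 => t _; rewrite invr_ge0.
have HD : harmonic_sum R #|` D| <= harmonic_sum R n.
  rewrite /harmonic_sum (@big_cat_nat _ _ _ #|` D|.+1 1 n.+1) //= lerDl.
  by apply: sumr_ge0 => t _; rewrite invr_ge0.
clearbody L; set h := harmonic_sum R n in HL HD.
pose B := 486 * M ^+ 2 * n%:R * h.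
have hB (P X : {fset R}) :
    \sum_(x <- X) (rep D P x)%:R ^+ 3 <= B * #|` P|%:R ^+ 2.
  apply: sum_rep_cube D0 K0 c0 KD Dn nK _ _; first by rewrite exprn_ege1.
  by rewrite CM exprMn.
have c0' : 0 <= 486 :> R := ler0n R 486.
have q0 : 0 <= 486 * M ^+ 2 * n%:R :=
  mulr_ge0 (mulr_ge0 c0' (exprn_ge0 2 M0)) (ler0n R n).
have B0 : 0 <= B := mulr_ge0 q0 (H0 n).
have BE : B = 486 * M ^+ 2 * n%:R * h by [].
clearbody B; have sT : 0 <= m ^+ 6 * v ^+ 7 by rewrite ?(exprn_ge0, mulr_ge0).
(* This level balances the low and high parts up to logarithms; as a square it has an explicit
   root. *)
pose T := (m ^+ 6 * v ^+ 7) ^+ 2.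
have T0 : 0 < T by rewrite !(exprn_gt0, mulr_gt0).
apply: le_trans (energy_le D0 T0 hB) _.
have low := low_energy_le D0 (ltW T0) hB.
set E := \sum_(u <- _ | _) _ in low *.
have E0 : 0 <= E by apply: sumr_ge0 => u _; rewrite exprn_ge0.
have Y0 : 0 <= m ^+ 14 * v ^+ 64 * L by rewrite ?(exprn_ge0, mulr_ge0).
have Dn' : #|` D|%:R <= v ^+ 26 :> R by rewrite -ev ler_nat.
(* Compared after sixth powers: [27 * 486 ^ 3 * 2 ^ 5 <= 100 ^ 6]. Five harmonic sums occur, three
   of them from [B ^ 3], and [L ^ 5 <= L ^ 6]. *)
have bound : E <= 100 * (m ^+ 14 * v ^+ 64 * L).
  rewrite -(@ler_pXn2r _ 6) ?nnegrE ?mulr_ge0 //.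
  apply: le_trans low _; rewrite /T sqrtr_sqr ger0_norm //.
  have sN : Num.sqrt #|` D|%:R <= v ^+ 13.
    by rewrite -(ger0_norm (exprn_ge0 13 (ltW v0))) -sqrtr_sqr -exprM ler_wsqrtr.
  apply: le_trans (_ : 27 * (m ^+ 6 * v ^+ 7) * v ^+ 13 * (v ^+ 26) ^+ 11 * B ^+ 3
     * (2 * L) ^+ 2 <= _).
    have p0 : 0 <= 27 * (m ^+ 6 * v ^+ 7) by rewrite mulr_ge0.
    apply: ler_pM; rewrite ?(exprn_ge0, mulr_ge0, sqrtr_ge0) ?H0 //; last first.
      by rewrite lerXn2r ?nnegrE ?mulr_ge0 ?H0 // (le_trans HD).
    rewrite ler_wpM2r ?exprn_ge0 //.
    apply: ler_pM; rewrite ?(exprn_ge0, mulr_ge0, sqrtr_ge0) //.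
      by rewrite ler_wpM2l.
    by rewrite lerXn2r ?nnegrE ?exprn_ge0 // ltW.
  apply: le_trans (_ : 27 * (m ^+ 6 * v ^+ 7) * v ^+ 13 * (v ^+ 26) ^+ 11 *
     (486 * M ^+ 2 * n%:R * (2 * L)) ^+ 3 * (2 * L) ^+ 2 <= _).
    rewrite BE ler_wpM2r ?exprn_ge0 ?mulr_ge0 // ler_wpM2l //.
      by rewrite ?(exprn_ge0, mulr_ge0).
    by rewrite lerXn2r ?nnegrE ?(mulr_ge0 q0) ?mulr_ge0 ?H0 // ler_wpM2l.
  rewrite em ev.
  have -> : 27 * (m ^+ 6 * v ^+ 7) * v ^+ 13 * (v ^+ 26) ^+ 11 *
     (486 * (m ^+ 13) ^+ 2 * v ^+ 26 * (2 * L)) ^+ 3 * (2 * L) ^+ 2 =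
     (27 * 486 ^+ 3 * 2 ^+ 5) * ((m ^+ 14 * v ^+ 64) ^+ 6 * L ^+ 5).
    ring.
  have -> : (100 * (m ^+ 14 * v ^+ 64 * L)) ^+ 6 =
    100 ^+ 6 * ((m ^+ 14 * v ^+ 64) ^+ 6 * L ^+ 5 * L) by ring.
  have z0 : 0 <= (m ^+ 14 * v ^+ 64) ^+ 6 * L ^+ 5.
    by rewrite ?(exprn_ge0, mulr_ge0).
  apply: le_trans (_ : 100 ^+ 6 * ((m ^+ 14 * v ^+ 64) ^+ 6 * L ^+ 5) <= _).
    by apply: ler_wpM2r => //; lra.
  by apply: ler_wpM2l; rewrite ?exprn_ge0 // ler_peMr.
(* Here [972 = 2 * 486] and [m ^ 26 v ^ 78 = m ^ 14 v ^ 64 T]; with the low part the constant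
   becomes [100 + 972 = 1072]. *)
have high : B * #|` D|%:R ^+ 2 / T <= 972 * (m ^+ 14 * v ^+ 64 * L).
  rewrite ler_pdivrMr //.
  apply: le_trans (_ : B * (v ^+ 26) ^+ 2 <= _).
    by rewrite ler_wpM2l // lerXn2r ?nnegrE ?exprn_ge0 // ltW.
  rewrite BE em ev.
  have -> : 486 * (m ^+ 13) ^+ 2 * v ^+ 26 * h * (v ^+ 26) ^+ 2 =
    486 * (m ^+ 26 * v ^+ 78) * h by ring.
  have -> : 972 * (m ^+ 14 * v ^+ 64 * L) * T =
    486 * (m ^+ 26 * v ^+ 78) * (2 * L) by rewrite /T; ring.
  apply: ler_wpM2l HL; apply: mulr_ge0 c0' _.
  by rewrite ?(exprn_ge0, mulr_ge0).
lra.
Qed.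

(** * Translates of [A] and the mixed energy *)

Lemma card_translate (R : realType) (A : {fset R}) (a : R) :
  #|` translate A a| = #|` A|.
Proof. by apply: card_imfset => x y /addIr. Qed.

(** For [a != 0], shifting [D] by [- a] returns to [A], and the multipliers [K] are taken from
    [A + 1]. For [a = 0] that shift would vanish, so the shift [1] is used with [K] from [A]. As
    [|A| >= 2], deleting [0] keeps at least half of a set. *)
Lemma translate_energy_le (R : realType) (A : {fset R}) (a M : R) :
  (2 <= #|` A|)%N -> 1 <= M ->
  #|` prodset A (translate A 1)|%:R = M * #|` A|%:R ->
  \sum_(u <- ratios (translate A a `\ 0))
    (rep (translate A a `\ 0) (translate A a `\ 0) u)%:R ^+ 2 <=
  1072 * (M `^ (14 / 13) * #|` A|%:R `^ (32 / 13) * log2 #|` A|%:R).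
Proof.
move=> A2 M1 CM; set D := translate A a `\ 0.
have remove0 (X : {fset R}) : #|` X| = #|` A| ->
    (#|` (X `\ 0)%R| <= #|` A|)%N /\ (#|` A| <= 2 * #|` (X `\ 0)%R|)%N.
  move=> XA; move: A2; rewrite -XA (cardfsD1 0%R X).
  by case: (0%R \in X); move: #|` _|; lia.
have zero (X : {fset R}) : 0 \notin X `\ 0 by rewrite !inE eqxx.
have [D1 D2] := remove0 _ (card_translate A a).
have [a0|a0] := eqVneq a 0.
  have [K1 K2] := remove0 A erefl.
  apply: structured_energy_le (zero _) (zero A) (oner_neq0 R) _ D1 A2 K2 M1 CM.
  move=> k d; rewrite !inE => /andP[_ kA] /andP[_ /imfsetP[x /= xA ->]].
  apply/imfset2P; exists k => //; exists (x + 1); last by rewrite a0 addr0.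
  by apply/imfsetP; exists x.
have [K1 K2] := remove0 _ (card_translate A 1).
have c0 : - a != 0 by rewrite oppr_eq0.
apply: structured_energy_le (zero _) (zero (translate A 1)) c0 _ D1 A2 K2 M1 CM.
move=> k d; rewrite !inE => /andP[_ kA] /andP[_ /imfsetP[x /= xA ->]].
by apply/imfset2P; exists x => //; exists k; rewrite // addrK mulrC.
Qed.

Lemma sum_rep_sqr_le (R : realFieldType) (D X : {fset R}) : 0 \notin D ->
  \sum_(u <- X) (rep D D u)%:R ^+ 2 <=
  \sum_(u <- ratios D) (rep D D u)%:R ^+ 2 :> R.
Proof.
move=> D0; rewrite (bigID (fun u => u \in ratios D)) /=.
rewrite [X in _ + X <= _]big1 ?addr0; last first.
  by move=> u uU; rewrite rep_notin_ratios // expr0n.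
rewrite [leRHS](bigID (fun u => u \in X)) /=.
apply: ler_wpDr; first by apply: sumr_ge0 => u _; apply: sqr_ge0.
rewrite -big_filter -[leRHS]big_filter le_eqVlt; apply/orP; left; apply/eqP.
apply: perm_big; apply: uniq_perm; rewrite ?filter_uniq ?fset_uniq //.
by move=> u; rewrite !mem_filter andbC.
Qed.

Lemma mul_energyE (R : realType) (A B : {fset R}) :
  mul_energy A B = (\sum_(a <- A) \sum_(a' <- A) \sum_(b <- B) \sum_(b' <- B)
    ((a * b)%R == (a' * b')%R))%N.
Proof.
rewrite /mul_energy card_fset_filter -sum_nat_bool (perm_big _ (perm_fsetM _ _)).
rewrite big_allpairs (perm_big _ (perm_fsetM _ _)) big_allpairs.
apply: eq_bigr => a _; apply: eq_bigr => a' _.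
by rewrite (perm_big _ (perm_fsetM _ _)) big_allpairs.
Qed.

Lemma sum_fsetD0 (R : realType) (S : nmodType) (A : {fset R}) (f : R -> S) :
  \sum_(x <- A | x != 0) f x = \sum_(x <- A `\ 0) f x.
Proof.
rewrite -big_filter; apply: perm_big; apply: uniq_perm.
- exact/filter_uniq/fset_uniq.
- exact: fset_uniq.
by move=> x; rewrite mem_filter !inE.
Qed.

(** Quadruples without zeros are sorted by the ratio [a / a' = b' / b], and a product of two counts
    is at most the mean of their squares. *)
Lemma mul_energy_le (R : realType) (A B : {fset R}) :
  (mul_energy A B)%:R <= (#|` A| + #|` B|)%:R ^+ 2 +
    (\sum_(u <- ratios (A `\ 0)) (rep (A `\ 0) (A `\ 0) u)%:R ^+ 2 +
     \sum_(u <- ratios (B `\ 0)) (rep (B `\ 0) (B `\ 0) u)%:R ^+ 2) / 2 :> R.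
Proof.
set A' := A `\ 0; set B' := B `\ 0.
have A0 : 0 \notin A' by rewrite !inE eqxx.
have B0 : 0 \notin B' by rewrite !inE eqxx.
(* [z a b] dominates the indicator of [a * b = 0]. A zero entry in a solution makes both products
   vanish, so [z a b * z a' b'] counts it, and the sum of these terms factors as a square. *)
pose z (a b : R) : R := (a == 0)%:R + (b == 0)%:R.
have z0 a b : 0 <= z a b by rewrite addr_ge0.
have pt (a a' b b' : R) : (a * b == a' * b')%:R <= z a b * z a' b' +
    (if a != 0 then if a' != 0 then if b != 0 then if b' != 0 then
      (a * b == a' * b')%:R else 0 else 0 else 0 else 0) :> R.
  rewrite /z; case: (eqVneq a 0) => [->|a0]; case: (eqVneq a' 0) => [->|a0'];
  case: (eqVneq b 0) => [->|b0]; case: (eqVneq b' 0) => [->|b0'] /=;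
  rewrite ?(mul0r, mulr0) ?eqxx ?(eq_sym 0) ?mulf_eq0 ?(negbTE a0) ?(negbTE a0')
    ?(negbTE b0) ?(negbTE b0') /=; lra.
have degenerate : \sum_(a <- A) \sum_(a' <- A) \sum_(b <- B) \sum_(b' <- B)
    z a b * z a' b' <= (#|` A| + #|` B|)%:R ^+ 2.
  have -> : \sum_(a <- A) \sum_(a' <- A) \sum_(b <- B) \sum_(b' <- B)
      z a b * z a' b' = (\sum_(a <- A) \sum_(b <- B) z a b) ^+ 2.
    rewrite expr2 big_distrl /=; apply: eq_bigr => a _.
    rewrite big_distrr /=; apply: eq_bigr => a' _.
    rewrite big_distrl /=; apply: eq_bigr => b _.
    by rewrite big_distrr.
  have one (X : {fset R}) : \sum_(x <- X) (x == 0)%:R <= 1 :> R.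
    by rewrite -natr_sum sum_nat_bool count_uniq_mem ?fset_uniq // lern1 leq_b1.
  have const (X : {fset R}) (k : R) : \sum_(x <- X) k = #|` X|%:R * k.
    by rewrite big_const_seq count_predT iter_addr_0 mulr_natl.
  rewrite lerXn2r ?nnegrE //.
    by apply: sumr_ge0 => a _; apply: sumr_ge0 => b _.
  under eq_bigr => a _ do rewrite big_split /= const.
  rewrite big_split /= const -mulr_sumr natrD addrC.
  by apply: lerD; apply: ler_piMr.
have nondegenerate : \sum_(a <- A) \sum_(a' <- A) \sum_(b <- B) \sum_(b' <- B)
    (if a != 0 then if a' != 0 then if b != 0 then if b' != 0 then
      (a * b == a' * b')%:R else 0 else 0 else 0 else 0) =
    \sum_(u <- ratios A') (rep A' A' u)%:R * (rep B' B' u)%:R :> R.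
  rewrite -(sum_sum_ratio _ A0) [RHS]exchange_big /=.
  rewrite -[RHS]sum_fsetD0 [RHS]big_mkcond; apply: eq_bigr => a _.
  case: ifP => _; last first.
    by rewrite big1 // => ? _; rewrite big1 // => ? _; rewrite big1.
  rewrite -[RHS]sum_fsetD0 [RHS]big_mkcond; apply: eq_bigr => a' _.
  case: ifPn => a0'; last by rewrite big1 // => ? _; rewrite big1.
  rewrite rep_natr -[RHS]sum_fsetD0 [RHS]big_mkcond; apply: eq_bigr => b _.
  case: ifP => _; last by rewrite big1.
  rewrite -big_mkcond sum_fsetD0 -natr_sum sum_nat_bool.
  rewrite -(count_uniq_mem _ (fset_uniq B')); congr (_%:R).
  apply: eq_count => b' /=; rewrite mulrAC -(can2_eq (mulfK a0') (divfK a0')).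
  by rewrite eq_sym [a' * _]mulrC.
have -> : (mul_energy A B)%:R = \sum_(a <- A) \sum_(a' <- A) \sum_(b <- B)
    \sum_(b' <- B) (a * b == a' * b')%:R :> R.
  rewrite mul_energyE natr_sum; apply: eq_bigr => a _.
  rewrite natr_sum; apply: eq_bigr => a' _.
  by rewrite natr_sum; apply: eq_bigr => b _; rewrite natr_sum.
apply: le_trans (_ : \sum_(a <- A) \sum_(a' <- A) \sum_(b <- B) \sum_(b' <- B)
    z a b * z a' b' + \sum_(a <- A) \sum_(a' <- A) \sum_(b <- B) \sum_(b' <- B)
    (if a != 0 then if a' != 0 then if b != 0 then if b' != 0 then
      (a * b == a' * b')%:R else 0 else 0 else 0 else 0) <= _).
  rewrite -big_split; apply: ler_sum => a _ /=.
  rewrite -big_split; apply: ler_sum => a' _ /=.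
  rewrite -big_split; apply: ler_sum => b _ /=.
  by rewrite -big_split; apply: ler_sum => b' _; apply: pt.
rewrite nondegenerate; apply: lerD => //.
apply: le_trans (_ : (\sum_(u <- ratios A') (rep A' A' u)%:R ^+ 2 +
  \sum_(u <- ratios A') (rep B' B' u)%:R ^+ 2) / 2 <= _).
  rewrite -big_split mulr_suml; apply: ler_sum => u _ /=.
  have := sqr_ge0 ((rep A' A' u)%:R - (rep B' B' u)%:R : R).
  by rewrite ler_pdivlMr // sqrrB; lra.
by rewrite ler_pM2r // lerD2l sum_rep_sqr_le.
Qed.

Theorem corollary34 (R : realType) :
  exists C : R, 0 < C /\
    forall (A : {fset R}) (a M : R),
      (2 <= #|` A|)%N ->
      1 <= M ->
      #|` prodset A (translate A 1)|%:R = M * #|` A|%:R ->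
      (mul_energy A (translate A a))%:R
        <= C * M `^ (14 / 13) * #|` A|%:R `^ (32 / 13)
             * log2 (#|` A|%:R) `^ (71 / 65)
      /\
      (mul_energy A A)%:R
        <= C * M `^ (14 / 13) * #|` A|%:R `^ (32 / 13)
             * log2 (#|` A|%:R) `^ (71 / 65).
Proof.
(* [1076 = 1072 + 4], where [4] accounts for the quadruples involving [0], at most [(2 n) ^ 2] in
   number. *)
exists 1076; split => [|A a M A2 M1 CM]; first by rewrite ltr0n.
set n := #|` A| in A2 CM *; set L := log2 _.
pose Y := M `^ (14 / 13) * n%:R `^ (32 / 13) * L.
have L1 : 1 <= L := ge1_log2 R A2.
have n1 : 1 <= n%:R :> R by rewrite ler1n (leq_trans _ A2).
have energyD x : \sum_(u <- ratios (translate A x `\ 0))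
    (rep (translate A x `\ 0) (translate A x `\ 0) u)%:R ^+ 2 <= 1072 * Y.
  exact: translate_energy_le.
have sqr_le : (n + n)%:R ^+ 2 <= 4 * Y.
  have -> : (n + n)%:R ^+ 2 = 4 * n%:R ^+ 2 :> R by rewrite natrD; ring.
  rewrite ler_wpM2l //.
  have e : n%:R ^+ 2 <= n%:R `^ (32 / 13) :> R.
    rewrite -powR_mulrn ?ler0n // ler_powR // ler_pdivlMr //; lra.
  have m1 : 1 <= M `^ (14 / 13).
    by have := ler_powR M1 (_ : 0 <= 14 / 13 :> R); rewrite powRr0; apply; lra.
  apply: le_trans e _; rewrite /Y -[leLHS]mul1r -[leLHS]mulr1.
  by rewrite !ler_pM ?mulr_ge0 ?powR_ge0 // ler_wpM2r ?powR_ge0.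
(* The bound [Y] carries a single logarithm; since [L >= 1], raising it to the power [71/65] only
   increases it. *)
have YL : 1076 * Y <= 1076 * M `^ (14 / 13) * n%:R `^ (32 / 13) * L `^ (71 / 65).
  rewrite -!mulrA; apply: (ler_wpM2l (ler0n R 1076)).
  rewrite /Y -mulrA; apply: (ler_wpM2l (powR_ge0 _ _)).
  apply: (ler_wpM2l (powR_ge0 _ _)).
  by rewrite -[leLHS](powRr1 (le_trans ler01 L1)) ler_powR //; lra.
have A_eq : translate A 0 = A.
  apply/fsetP => x; apply/imfsetP/idP => [[y /= yA ->]|xA]; first by rewrite addr0.
  by exists x; rewrite ?addr0.
have all x : (mul_energy A (translate A x))%:R <= 1076 * Y.
  apply: le_trans (mul_energy_le _ _) _; rewrite card_translate -/n.
  have := energyD 0; rewrite A_eq; have := energyD x; lra.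
split; first exact: le_trans (all a) YL.
by rewrite -{2}A_eq; apply: le_trans (all 0) YL.
Qed.
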